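(* Let $n\ge2$, $L\ge0$ and $j,k\in\{0,\dots,n-1\}$, and let $r\in\{1,\dots,n\}$ be determined by $L+j-2k\equiv r\pmod n$. Then $$\sum_{\vec m}q^{\vec m^{\,t}C^{-1}\vec m-\vec m^{\,t}C^{-1}\vec e_{n-j}}\prod_{i=1}^{n-1}\begin{bmatrix}\big(\vec m+C^{-1}(L\vec e_{n-1}+\vec e_r+\vec e_{n-j}-2\vec m)\big)_i\\ m_i\end{bmatrix}_q = q^{(|\Lambda_k|^2-|\Lambda_j|^2)/2}\sum_{w\in\mathcal W}(\det w)\,b_{L,j-k}\big(\Lambda_k+\Lambda_{j-k+L}+\rho-w(\Lambda_0+\Lambda_j+\rho)\big),$$ where the sum on the left is over all $\vec m=(m_1,\dots,m_{n-1})^t\in\mathbb{Z}_{\ge0}^{n-1}$ with $\frac{k}{n}+(C^{-1}\vec m)_{n-1}\in\mathbb{Z}$.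
   Context: $\widehat{sl(n)}$ has fundamental weights $\Lambda_0,\dots,\Lambda_{n-1}$ (indices extended modulo $n$) and null root $\delta$; $P=\mathbb{Z}\Lambda_0\oplus\dots\oplus\mathbb{Z}\Lambda_{n-1}\oplus\mathbb{Z}\delta$ carries the symmetric bilinear form with $(\Lambda_i|\Lambda_j)=\min(i,j)-ij/n$, $(\Lambda_i|\delta)=1$, $(\delta|\delta)=0$ ($0\le i,j\le n-1$), and $|\lambda|^2=(\lambda|\lambda)$. $\hat i=\Lambda_{i+1}-\Lambda_i$, $\rho=\sum_{i=0}^{n-1}\Lambda_i$. $\mathcal W$ is the Weyl group of $\widehat{sl(n)}$ acting on $P$, generated by $s_i(\lambda)=\lambda-(\lambda|\alpha_i)\alpha_i$ with simple roots $\alpha_i=2\Lambda_i-\Lambda_{i-1}-\Lambda_{i+1}$ ($1\le i\le n-1$), $\alpha_0=2\Lambda_0-\Lambda_1-\Lambda_{n-1}+\delta$, and $\det w=(-1)^{\text{length}(w)}$. For $\lambda\in P$ and $i\in\mathbb{Z}$: if $\lambda=\sum_{s=0}^{n-1}\lambda_s\hat s+c\delta$ with integers $\lambda_s\ge0$, $\sum_s\lambda_s=L$, $c\in\mathbb{Z}$, then $b_{L,i}(\lambda)=q^{|\lambda-\Lambda_{i+L}|^2/2}\frac{(q)_L}{(q)_{\lambda_0}\cdots(q)_{\lambda_{n-1}}}$; otherwise $b_{L,i}(\lambda)=0$. $C$ is the Cartan matrix of $sl(n)$ ($C_{ij}=2\delta_{ij}-\delta_{i,j-1}-\delta_{i,j+1}$),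 $(C^{-1})_{ij}=i(n-j)/n$ for $i\le j$, $j(n-i)/n$ for $i>j$. $\vec e_i$ is the $i$-th unit vector of $\mathbb{R}^{n-1}$ for $1\le i\le n-1$ and $\vec e_n=\vec 0$. $\begin{bmatrix}N\\ m\end{bmatrix}_q=\frac{(q)_N}{(q)_m(q)_{N-m}}$ if $0\le m\le N$, else $0$; $(q)_m=\prod_{s=1}^m(1-q^s)$. *)

(* Defs.v *)
From HB Require Import structures.
From mathcomp Require Import all_boot all_order all_algebra.
From mathcomp Require Import boolp classical_sets cardinality fsbigop.
Set Implicit Arguments. Unset Strict Implicit. Unset Printing Implicit Defensive.
Import Order.TTheory GRing.Theory Num.Theory.
Local Open Scope ring_scope.
Local Open Scope classical_set_scope.

Definition qpoch (m : nat) : {poly rat} := \prod_(1 <= s < m.+1) (1 - 'X^s).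

(* [N ; m]_q for an integer N (given as a rational): (q)_N/((q)_m (q)_{N-m}) if 0<=m<=N, else 0.
   The quotient is exact (polynomial division). *)
Definition qbinom (N : rat) (m : nat) : {poly rat} :=
  if (N \is a Num.nat) && (m <= Num.truncn N)%N then
    qpoch (Num.truncn N) %/ (qpoch m * qpoch (Num.truncn N - m))
  else 0.

(* a "q-term" (e, p) stands for q^e * p(q), e rational *)
Definition qterm := (rat * {poly rat})%type.

Definition qcoef (t : qterm) (x : rat) : rat :=
  let d := x - t.1 in if d \is a Num.nat then t.2`_(Num.truncn d) else 0.

(* Equality of two (possibly infinite) sums of q-terms as formal series in rational
   powers of q: for every exponent x only finitely many terms contribute to the
   coefficient of q^x on each side, and these coefficients agree. *)
Definition qseries_eq (I J : choiceType) (A : set I) (f : I -> qterm)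
    (B : set J) (g : J -> qterm) : Prop :=
  forall x : rat,
    finite_set [set i | A i /\ qcoef (f i) x != 0] /\
    finite_set [set j | B j /\ qcoef (g j) x != 0] /\
    \sum_(i \in A) qcoef (f i) x = \sum_(j \in B) qcoef (g j) x.

(* ---------- the Cartan matrix data of sl(n) (1-based indices) ---------- *)

(* (C^{-1})_{ab}, 1 <= a,b <= n-1 *)
Definition Cinv (n a b : nat) : rat :=
  if (a <= b)%N then (a * (n - b))%:R / n%:R else (b * (n - a))%:R / n%:R.

(* (e_i)_a for 1 <= a <= n-1; e_n = 0 automatically since a <> n *)
Definition ev (i a : nat) : rat := (a == i)%:R.

(* A weight sum_{t<n} a_t Lambda_t + c delta is the row vector (a_0,...,a_{n-1},c). *)
Definition wt (n : nat) := 'rV[rat]_(n.+1).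

Definition Lam (n t : nat) : wt n := \row_(a < n.+1) ((a == (t %% n)%N :> nat)%:R).
Definition deltaW (n : nat) : wt n := \row_(a < n.+1) ((a == n :> nat)%:R).
Definition rho (n : nat) : wt n := \sum_(t < n) Lam n t.
Definition hatW (n s : nat) : wt n := Lam n s.+1 - Lam n s.

Definition form (n : nat) (u v : wt n) : rat :=
  \sum_(a < n.+1) \sum_(b < n.+1)
     u 0 a * v 0 b *
     (if ((a < n) && (b < n))%N then (minn a b)%:R - (a * b)%:R / n%:R
      else if ((a < n) && (b == n :> nat))%N || ((a == n :> nat) && (b < n))%N then 1
      else 0).

Definition sqn (n : nat) (u : wt n) : rat := form u u.

Definition alpha (n i : nat) : wt n :=
  2%:R *: Lam n i - Lam n (i + n - 1) - Lam n i.+1 + (i == 0)%N%:R *: deltaW n.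

Definition sref (n i : nat) (l : wt n) : wt n := l - form l (alpha n i) *: alpha n i.

(* matrix of s_i acting on row vectors: l *m genmx i = sref i l *)
Definition genmx (n i : nat) : 'M[rat]_(n.+1) :=
  \matrix_(a < n.+1, b < n.+1) (sref i (delta_mx 0 a) 0 b).

(* The Weyl group W (as the group of matrices generated by s_0,...,s_{n-1});
   w acts by l |-> l *m w, and det w is the determinant of w. *)
Definition Weyl (n : nat) : set 'M[rat]_(n.+1) :=
  [set M | exists ws : seq 'I_n, M = \prod_(i <- ws) genmx n i].

Definition brep (n L : nat) (l : wt n) (lam : {ffun 'I_n -> 'I_L.+1}) : bool :=
  let mu := l - \sum_(s < n) (lam s : nat)%:R *: hatW n s in
  [&& (\sum_(s < n) (lam s : nat) == L)%N,
      mu == mu 0 ord_max *: deltaW n &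
      mu 0 ord_max \is a Num.int].

Definition bfun (n L : nat) (i : int) (l : wt n) : qterm :=
  match [pick lam | @brep n L l lam] with
  | Some lam =>
      (sqn (l - Lam n (`|(i + L%:Z) %% n%:Z|%Z)%N) / 2%:R,
       qpoch L %/ \prod_(s < n) qpoch (lam s))
  | None => (0, 0)
  end.

(* vectors of R^{n-1} given by their 1-based coordinate functions;
   (C^{-1} v)_a = sum_{b=1}^{n-1} (C^{-1})_{ab} v_b *)
Definition Cv (n : nat) (v : nat -> rat) (a : nat) : rat :=
  \sum_(b < n.-1) Cinv n a b.+1 * v b.+1.

(* m = (m_1,...,m_{n-1}) stored 0-based: m_a = m (a-1) *)
Definition mvec (n : nat) (m : {ffun 'I_n.-1 -> nat}) (a : nat) : rat :=
  \sum_(i < n.-1) (i.+1 == a)%:R * (m i)%:R.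

Definition lhs_dom (n k : nat) : set {ffun 'I_n.-1 -> nat} :=
  [set m | k%:R / n%:R + Cv n (mvec m) n.-1 \is a Num.int].

Definition lhs_term (n L j r : nat) (m : {ffun 'I_n.-1 -> nat}) : qterm :=
  (\sum_(i < n.-1) (m i)%:R * Cv n (mvec m) i.+1
     - \sum_(i < n.-1) (m i)%:R * Cv n (ev (n - j)) i.+1,
   \prod_(i < n.-1)
     qbinom ((m i)%:R + Cv n (fun b => L%:R * ev n.-1 b + ev r b + ev (n - j) b
                                        - 2%:R * mvec m b) i.+1) (m i)).

Definition rhs_term (n L j k : nat) (w : 'M[rat]_(n.+1)) : qterm :=
  let mu := Lam n k + Lam n (j + L + n - k) + rho n
            - (Lam n 0 + Lam n j + rho n) *m w in
  let bt := bfun L (j%:Z - k%:Z) mu in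
  ((sqn (Lam n k) - sqn (Lam n j)) / 2%:R + bt.1, \det w *: bt.2).

(* Main.v *)
(** Both sides are generating functions of the words that increment one of two
    cyclic pointers (k, k') modulo n, where a switch of pointer at time L costs
    L r / n, r = k' - k being their distance; L counts the steps.

    Bosonic side: the q-multinomial recurrence expresses the Weyl group sum at
    level L + 1 through n sums at level L, one for each last step.  All of them but
    those which increment k or k' have a weight fixed by a simple reflection, so
    that they vanish by antisymmetry.  This is a first order recurrence in L.

    Fermionic side: write x_i = N_i - m_i for the differences of the entries of
    the i-th q-binomial coefficient, so that 2 m = L e_{n-1} + e_r + e_{n-j} - C x.
    Pascal's rule, applied to one factor after the other and combined with the
    translations m -> m - C e_s of the summation lattice, telescopes to the second
    order recurrence
      F_{L+1}(k+1, r) = F_L(k+1, r-1)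
        + q^{(r-L)/n} (F_L(k, r+1) + (q^L - 1) F_{L-1}(k, r))   (0 < r < n),
    while F_L(k, 0) = F_L(k, n) and F_{L+1}(k, n) = F_L(k, n-1) hold term by term.
    Eliminating one of the two pointers from the bosonic recurrence gives the same
    relations, and both sides agree for L = 0. *)

From Pilot Require Import Defs.
From HB Require Import structures.
From mathcomp Require Import all_boot all_order all_fingroup all_algebra.
From mathcomp Require Import boolp classical_sets cardinality fsbigop.
From mathcomp Require Import ring lra zify.
(* mathcomp's sesquilinear forms would otherwise hide [Defs.form] *)
Import Pilot.Defs.
Import Order.TTheory GRing.Theory Num.Theory.
Local Open Scope ring_scope.

Set Implicit Arguments.
Unset Strict Implicit.
Unset Printing Implicit Defensive.

(** * q-binomial coefficients and finitely supported sums *)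

(** Every identity is proved for the coefficient of one rational exponent [x]: a power of q becomes
    a shift of [x], and the price is that each rearrangement needs finite support. On the fermionic
    side this follows from the positive entries of C^{-1}, on the bosonic side from the freeness of
    the Weyl group action on strictly dominant weights, even modulo delta.

    The order two of the common recurrence has its source on the bosonic side. A switch exchanges
    the roles of the pointers and so leads from distance r to distance n - r - 1, whereas the
    fermionic telescoping relates only r - 1, r and r + 1. Two bosonic relations share the exchanged
    term; their costs L (r + 1) / n and L (n - r - 1) / n add up to L, hence the factor q^L - 1.

    Pascal's rule fails at the entry (0, 0). This is why the telescoping runs at a positive level:
    with x_0 = 0 and x_n > 0, concavity of x excludes the bad entry whenever the other factors do
    not vanish. *)

Lemma qpochS m : qpoch m.+1 = qpoch m * (1 - 'X^(m.+1)).
Proof. by rewrite /qpoch big_nat_recr. Qed.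

Lemma qpoch0 : qpoch 0 = 1.
Proof. by rewrite /qpoch big_geq. Qed.

Lemma one_subXn_neq0 m : 1 - 'X^(m.+1) != 0 :> {poly rat}.
Proof.
rewrite subr_eq0; apply/eqP => /(congr1 (fun p : {poly rat} => size p)).
by rewrite size_poly1 size_polyXn.
Qed.

Lemma qpoch_neq0 m : qpoch m != 0.
Proof.
elim: m => [|m IH]; first by rewrite qpoch0 oner_neq0.
by rewrite qpochS mulf_neq0 ?one_subXn_neq0.
Qed.

Lemma qcoef0 e x : qcoef (e, 0) x = 0.
Proof. by rewrite /qcoef /= coef0 if_same. Qed.

Lemma qcoefD e p1 p2 x : qcoef (e, p1 + p2) x = qcoef (e, p1) x + qcoef (e, p2) x.
Proof. by rewrite /qcoef /=; case: ifP => _; rewrite ?coefD ?addr0. Qed.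

Lemma qcoefZ e c p x : qcoef (e, c *: p) x = c * qcoef (e, p) x.
Proof. by rewrite /qcoef /=; case: ifP => _; rewrite ?coefZ ?mulr0. Qed.

Lemma qcoef_sum (I : finType) (P : pred I) e (p : I -> {poly rat}) x :
  qcoef (e, \sum_(i | P i) p i) x = \sum_(i | P i) qcoef (e, p i) x.
Proof.
by apply: (big_morph (fun p => qcoef (e, p) x)) => [p1 p2|]; rewrite ?qcoefD ?qcoef0.
Qed.

Lemma qcoef_shift e a p x : qcoef (e + a, p) x = qcoef (e, p) (x - a).
Proof. by rewrite /qcoef /=; have -> : x - (e + a) = x - a - e by ring. Qed.

Lemma truncn_natr (m : nat) : Num.truncn (m%:R : rat) = m.
Proof. exact: natrK. Qed.

Lemma qcoefXn e d p x : qcoef (e, 'X^d * p) x = qcoef (e + d%:R, p) x.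
Proof.
rewrite /qcoef /=; case: (boolP (x - (e + d%:R) \is a Num.nat)) => [/natrP [t xt]|].
  have -> : x - e = (t + d)%:R by rewrite natrD -xt; ring.
  by rewrite natr_nat xt !truncn_natr coefXnM ltnNge leq_addl addnK.
case: ifP => // /natrP [t xt] nt; rewrite xt truncn_natr coefXnM.
case: ltnP => // ledt; case/negP: nt.
have -> : x - (e + d%:R) = (t - d)%:R by rewrite natrB // -xt; ring.
exact: natr_nat.
Qed.

(** The quotient is built by Pascal's rule, from 1 - X^(N+1) = (1 - X^(N-m)) + X^(N-m) (1 -
    X^(m+1)). Hence the polynomial division in [qbinom] is exact. *)
Lemma qpoch_dvd N m : (m <= N)%N -> exists p, qpoch N = p * (qpoch m * qpoch (N - m)).
Proof.
elim: N m => [|N IH] [|m] // lemN.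
- by exists 1; rewrite qpoch0 !mul1r.
- by exists 1; rewrite qpoch0 !mul1r subn0.
move: lemN; rewrite ltnS leq_eqVlt => /orP [/eqP ->|ltmN].
  by exists 1; rewrite subnn qpoch0 mulr1 mul1r.
have [p1 E1] := IH m (ltnW ltmN); have [p2 E2] := IH _ ltmN.
exists (p2 + 'X^(N - m) * p1).
rewrite subSS mulrDl qpochS.
have sN : (N - m = (N - m.+1).+1)%N by rewrite subnSK.
have EN : qpoch (N - m) = qpoch (N - m.+1) * (1 - 'X^(N - m)) by rewrite sN qpochS.
transitivity (qpoch N * (1 - 'X^(N - m)) + 'X^(N - m) * (qpoch N * (1 - 'X^(m.+1)))).
  have -> : 'X^(N.+1) = 'X^(N - m) * 'X^(m.+1) :> {poly rat}.
    by rewrite -exprD addnS subnK // ltnW.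
  by move: 'X^(N - m) 'X^(m.+1) => a b; ring.
congr (_ + _); first by rewrite [in LHS]E2 EN; move: 'X^(N - m) => a; ring.
by rewrite [in LHS]E1 [qpoch m.+1]qpochS; move: 'X^(N - m) 'X^(m.+1) => a b; ring.
Qed.

(* Extending [qbinom] by 0 to all rational lower arguments makes Pascal's rule
   valid for every (N, M) <> (0, 0), so that the summation lattice can be Z^(n-1). *)
Definition qbin (N M : rat) : {poly rat} :=
  if M \is a Num.nat then qbinom N (Num.truncn M) else 0.

Lemma qbin_natE (N m : nat) : (m <= N)%N ->
  qbin N%:R m%:R * (qpoch m * qpoch (N - m)) = qpoch N.
Proof.
move=> lemN; rewrite /qbin natr_nat /qbinom natr_nat !truncn_natr lemN /=.
have [p E] := qpoch_dvd lemN.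
by rewrite E mulpK // mulf_neq0 ?qpoch_neq0.
Qed.

Lemma qbin_out (N M : rat) :
  ~ (exists m d : nat, M = m%:R /\ N = (m + d)%:R) -> qbin N M = 0.
Proof.
move=> H; rewrite /qbin; case: ifP => // /natrP [m Em]; rewrite /qbinom.
case: ifP => // /andP [/natrP [k Ek] le_mk].
case: H; exists m, (k - m)%N; split=> //; rewrite Ek subnKC //.
by move: le_mk; rewrite Em Ek !truncn_natr.
Qed.

Lemma qbin_neq0P (N M : rat) :
  qbin N M != 0 -> exists m d : nat, M = m%:R /\ N = (m + d)%:R.
Proof.
move=> nz; apply: contrapT => H; move: nz.
by rewrite qbin_out ?eqxx.
Qed.

Lemma qbin_n0 (N : nat) : qbin N%:R 0 = 1.
Proof.
have := qbin_natE (leq0n N); rewrite qpoch0 subn0 mul1r mulr0n => E.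
by apply: (mulIf (qpoch_neq0 N)); rewrite E mul1r.
Qed.

Lemma qbin_nn (N : nat) : qbin N%:R N%:R = 1.
Proof.
have := qbin_natE (leqnn N); rewrite subnn qpoch0 mulr1 => E.
by apply: (mulIf (qpoch_neq0 N)); rewrite E mul1r.
Qed.

Lemma qbin_pascal (m d : nat) : (0 < m + d)%N ->
  qbin (m + d)%:R m%:R =
  qbin ((m + d)%:R - 1) m%:R + 'X^d * qbin ((m + d)%:R - 1) (m%:R - 1).
Proof.
case: m => [|m].
  case: d => // d _; rewrite !add0n -[in RHS]natr1 addrK !qbin_n0 qbin_out ?mulr0 ?addr0 //.
  by move=> [m [k [E _]]]; have : (0 : rat) <= m%:R by []; rewrite -E; lra.
move=> _; rewrite addSn -[(m + d).+1%:R]natr1 -[m.+1%:R]natr1 !addrK !natr1.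
case: d => [|d].
  rewrite addn0 mul1r !qbin_nn qbin_out ?add0r // => [[a [b [/eqP]]]].
  by rewrite eqr_nat => /eqP <- /eqP; rewrite eqr_nat -[in X in X == _](addn0 m) => /eqP; lia.
have nz : qpoch m.+1 * qpoch d.+1 != 0 by rewrite mulf_neq0 ?qpoch_neq0.
apply: (mulIf nz).
have := @qbin_natE (m + d.+1).+1 m.+1 ltac:(lia).
have := @qbin_natE (m + d.+1) m.+1 ltac:(lia).
have := @qbin_natE (m + d.+1) m ltac:(lia).
have -> : ((m + d.+1).+1 - m.+1 = d.+1)%N by lia.
have -> : (m + d.+1 - m.+1 = d)%N by lia.
have -> : (m + d.+1 - m = d.+1)%N by lia.
move=> E1 E2 ->; rewrite mulrDl [qpoch d.+1]qpochS.
have -> : qbin (m + d.+1)%:R m.+1%:R * (qpoch m.+1 * (qpoch d * (1 - 'X^(d.+1))))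
  = qpoch (m + d.+1) * (1 - 'X^(d.+1)) by rewrite -E2; ring.
have -> : 'X^(d.+1) * qbin (m + d.+1)%:R m%:R * (qpoch m.+1 * (qpoch d * (1 - 'X^(d.+1))))
  = qpoch (m + d.+1) * ('X^(d.+1) * (1 - 'X^(m.+1))) by rewrite -E1 !qpochS; ring.
have -> : 'X^(d.+1) * (1 - 'X^(m.+1)) = 'X^(d.+1) - 'X^((m + d.+1).+1) :> {poly rat}.
  by rewrite mulrBr mulr1 -exprD; congr (_ - 'X^_); lia.
by rewrite qpochS; ring.
Qed.

(** The cofactor [p] stands for the other factors of a product: if it vanishes, the exceptional
    entry (0, 0) does no harm. *)
Lemma qcoef_pascal (N M : rat) e p x : p = 0 \/ (N != 0 \/ M != 0) ->
  qcoef (e, qbin N M * p) x =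
  qcoef (e, qbin (N - 1) M * p) x + qcoef (e + (N - M), qbin (N - 1) (M - 1) * p) x.
Proof.
case=> [->|nz]; first by rewrite !mulr0 !qcoef0 addr0.
have [[m [d [EM EN]]]|H] := pselect (exists m d : nat, M = m%:R /\ N = (m + d)%:R).
  rewrite EM EN qbin_pascal; last first.
    by move: nz; rewrite EM EN !pnatr_eq0; lia.
  rewrite mulrDl qcoefD; congr (_ + _).
  by rewrite -mulrA qcoefXn natrD; congr (qcoef (e + _, _) x); ring.
rewrite (qbin_out H) (@qbin_out (N - 1) M) ?(@qbin_out (N - 1) (M - 1)) ?mul0r ?qcoef0 ?addr0 //.
  move=> [m [d [EM EN]]]; apply: H; exists m.+1, d; rewrite addSn -!natr1 -EM -EN; split; ring.
move=> [m [d [EM EN]]]; apply: H; exists m, d.+1; rewrite addnS -natr1 -EM -EN; split; ring.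
Qed.

(** * Finitely supported sums *)

Definition fsupp (I : choiceType) (f : I -> rat) := finite_set [set i | f i != 0].

Definition fsum (I : choiceType) (f : I -> rat) : rat := \sum_(i \in [set: I]) f i.

Lemma fsuppS (I : choiceType) (A : set I) (f : I -> rat) :
  finite_set A -> (forall i, f i != 0 -> A i) -> fsupp f.
Proof. by move=> fA fsub; apply: sub_finite_set fA => i /fsub. Qed.

Lemma fsuppD (I : choiceType) (f g : I -> rat) :
  fsupp f -> fsupp g -> fsupp (fun i => f i + g i).
Proof.
move=> ff fg; have : finite_set ([set i | f i != 0] `|` [set i | g i != 0])%classic.
  by rewrite finite_setU.
move/fsuppS; apply => i; rewrite /=.
by case: (eqVneq (f i) 0) => [->|]; [rewrite add0r; right | left].
Qed.

Lemma fsupp0 (I : choiceType) : fsupp (fun _ : I => 0).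
Proof. by apply: (@fsuppS _ set0) => // i; rewrite eqxx. Qed.

Lemma fsupp_sum (I : choiceType) (J : Type) (s : seq J) (f : J -> I -> rat) :
  (forall j, fsupp (f j)) -> fsupp (fun i => \sum_(j <- s) f j i).
Proof.
move=> ff; elim: s => [|j s IH].
  by under eq_fun do rewrite big_nil; exact: fsupp0.
by under eq_fun do rewrite big_cons; apply: fsuppD.
Qed.

Lemma fsum_seq (I : choiceType) (f : I -> rat) (s : seq I) :
  uniq s -> (forall i, f i != 0 -> i \in s) -> fsum f = \sum_(i <- s) f i.
Proof.
move=> us fsub; rewrite /fsum fsbig_supp; apply: fsbig_fwiden => //.
  by move=> i [_ /= /eqP]; apply: fsub.
move=> i [_ /= ni]; apply/eqP; apply: contraT => nz.
by case: ni; split => //; apply/eqP.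
Qed.

Lemma finite_set_seq (I : choiceType) (A : set I) :
  finite_set A -> exists2 s : seq I, uniq s & forall i, A i -> i \in s.
Proof.
move=> /finite_seqP [s ->]; exists (undup s); rewrite ?undup_uniq // => i.
by rewrite mem_undup.
Qed.

Lemma fsumD (I : choiceType) (f g : I -> rat) :
  fsupp f -> fsupp g -> fsum (fun i => f i + g i) = fsum f + fsum g.
Proof.
move=> ff fg; have : finite_set ([set i | f i != 0] `|` [set i | g i != 0])%classic.
  by rewrite finite_setU.
move=> /finite_set_seq [s us mem].
rewrite !(@fsum_seq _ _ s) ?big_split //.
- by move=> i nz; apply: mem; right.
- by move=> i nz; apply: mem; left.
move=> i nz; apply: mem; rewrite /=.
by case: (eqVneq (f i) 0) nz => [->|]; [rewrite add0r; right | left].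
Qed.

Lemma fsumN (I : choiceType) (f : I -> rat) : fsum (fun i => - f i) = - fsum f.
Proof.
rewrite -mulN1r /fsum mulr_fsumr; apply: eq_fsbigr => i _; by rewrite mulN1r.
Qed.

Lemma fsum0 (I : choiceType) (f : I -> rat) : (forall i, f i = 0) -> fsum f = 0.
Proof. by move=> H; apply: fsbig1 => i _. Qed.

Lemma fsum_sum (I : choiceType) (J : Type) (s : seq J) (f : J -> I -> rat) :
  (forall j, fsupp (f j)) ->
  fsum (fun i => \sum_(j <- s) f j i) = \sum_(j <- s) fsum (f j).
Proof.
move=> ff; elim: s => [|j s IH].
  by rewrite big_nil; apply: fsum0 => i; rewrite big_nil.
under eq_fun do rewrite big_cons.
by rewrite big_cons -IH fsumD //; apply: fsupp_sum.
Qed.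

Lemma fsum_bij (I J : choiceType) (h : I -> J) (f : J -> rat) :
  bijective h -> fsum f = fsum (fun i => f (h i)).
Proof. by move=> bh; rewrite /fsum (reindex_fsbigT h). Qed.

Lemma fsum_set1 (I : choiceType) (f : I -> rat) i0 :
  (forall i, i != i0 -> f i = 0) -> fsum f = f i0.
Proof.
move=> H; rewrite (@fsum_seq _ _ [:: i0]) ?big_seq1 // => i nz.
by rewrite inE; apply: contraNT nz => /H ->.
Qed.

(** * Fermionic side *)

Section Fermion.

Variable n : nat.
Hypothesis hn : (2 <= n)%N.

Local Notation V := {ffun 'I_n.-1 -> int}.

(** * The inverse Cartan matrix as a discrete Green function *)

Definition mcoord (m : V) (a : nat) : rat := \sum_(i < n.-1) (i.+1 == a)%:R * (m i)%:~R.

Definition unitv (a : nat) : V := [ffun i : 'I_n.-1 => ((i.+1 == a)%N : nat)%:Z].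

(** This closed form extends C^{-1} by 0 to the indices 0 and n, so that second differences may be
    taken at every interior index without boundary cases. *)
Definition cinv (a b : nat) : rat := (minn a b)%:R - a%:R * b%:R / n%:R.

Lemma n_neq0 : n%:R != 0 :> rat.
Proof. by rewrite pnatr_eq0; lia. Qed.

Lemma CinvE a b : (a <= n)%N -> (b <= n)%N -> Cinv n a b = cinv a b.
Proof.
move=> an bn; rewrite /Cinv /cinv; have := n_neq0.
case: leqP => ab nz.
  by rewrite natrM natrB //; field.
by rewrite natrM natrB //; field.
Qed.

Lemma cinvC a b : cinv a b = cinv b a.
Proof. by rewrite /cinv minnC [a%:R * _]mulrC. Qed.

Lemma cinv0 a : cinv a 0 = 0.
Proof. by rewrite /cinv minn0 mulr0 mul0r subrr. Qed.

Lemma cinvn a : (a <= n)%N -> cinv a n = 0.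
Proof. by move=> an; rewrite /cinv (minn_idPl an) mulfK ?subrr ?n_neq0. Qed.

Lemma cinv_diff a t : cinv a t.+1 - cinv a t = (t < a)%:R - a%:R / n%:R.
Proof.
rewrite /cinv -natr1; have nz := n_neq0.
have -> : (minn a t.+1)%:R = (minn a t)%:R + (t < a)%:R :> rat.
  by rewrite -natrD; congr (_%:R); lia.
by field.
Qed.

Lemma big_ord_pick (f : nat -> rat) a :
  \sum_(i < n.-1) (i.+1 == a)%:R * f i.+1 = ((0 < a < n)%N)%:R * f a.
Proof.
case: (boolP (0 < a < n)%N) => Ha.
  have Ha' : (a.-1 < n.-1)%N by lia.
  rewrite (bigD1 (Ordinal Ha')) //= big1 => [|i]; last first.
    rewrite -val_eqE /= => ne; case: eqP => [E|]; last by rewrite mul0r.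
    by move: ne; rewrite -E /= eqxx.
  by rewrite prednK ?eqxx ?addr0 //; lia.
rewrite mul0r big1 // => i _; case: eqP => [E|]; last by rewrite mul0r.
by have := ltn_ord i; move: Ha; rewrite -E; lia.
Qed.

Lemma mcoordD m d a : mcoord (m + d) a = mcoord m a + mcoord d a.
Proof.
by rewrite /mcoord -big_split /=; apply: eq_bigr => i _; rewrite ffunE intrD mulrDr.
Qed.

Lemma mcoordN m a : mcoord (- m) a = - mcoord m a.
Proof.
by rewrite /mcoord -sumrN; apply: eq_bigr => i _; rewrite ffunE intrN mulrN.
Qed.

Lemma mcoordS m (i : 'I_n.-1) : mcoord m i.+1 = (m i)%:~R.
Proof.
rewrite /mcoord (bigD1 i) //= eqxx mul1r big1 ?addr0 // => k ne.
by rewrite eqSS val_eqE (negbTE ne) mul0r.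
Qed.

Lemma mcoord_unit t a : mcoord (unitv t) a = ((0 < a < n)%N && (a == t))%:R.
Proof.
transitivity (\sum_(i < n.-1) (i.+1 == a)%:R * ((i.+1 == t)%N)%:R : rat).
  by apply: eq_bigr => i _; rewrite ffunE.
by rewrite (big_ord_pick (fun b => (b == t)%:R)) -natrM mulnb.
Qed.

Lemma CvE f a : (a <= n)%N -> Cv n f a = \sum_(b < n.-1) cinv a b.+1 * f b.+1.
Proof.
by move=> an; apply: eq_bigr => b _; rewrite CinvE //; have := ltn_ord b; lia.
Qed.

Lemma CvD f g a : Cv n (fun b => f b + g b) a = Cv n f a + Cv n g a.
Proof. by rewrite /Cv -big_split; apply: eq_bigr => b _; rewrite mulrDr. Qed.

Lemma CvZ c f a : Cv n (fun b => c * f b) a = c * Cv n f a.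
Proof. by rewrite /Cv mulr_sumr; apply: eq_bigr => b _; rewrite mulrCA. Qed.

Lemma Cv_ext f g a : (forall b, (0 < b < n)%N -> f b = g b) -> Cv n f a = Cv n g a.
Proof.
by move=> H; apply: eq_bigr => b _; rewrite H //; have := ltn_ord b; lia.
Qed.

Lemma Cv_ev r a : (r <= n)%N -> (a <= n)%N -> Cv n (ev r) a = cinv a r.
Proof.
move=> rn an; rewrite CvE //.
rewrite (eq_bigr (fun b : 'I_n.-1 => (b.+1 == r)%:R * cinv a b.+1)) => [|b _]; last first.
  by rewrite mulrC.
rewrite big_ord_pick; case: (boolP (0 < r < n)%N) => [|Hr]; first by rewrite mul1r.
rewrite mul0r; have [->|rpos] := posnP r; first by rewrite cinv0.
by rewrite (_ : r = n) ?cinvn //; lia.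
Qed.

Lemma Cv_mcoord_unit t a : (t <= n)%N -> (a <= n)%N -> Cv n (mcoord (unitv t)) a = cinv a t.
Proof.
move=> tn an; rewrite -Cv_ev //; apply: Cv_ext => b Hb.
by rewrite mcoord_unit Hb.
Qed.

Lemma Cv_mcoordD m d a : Cv n (mcoord (m + d)) a = Cv n (mcoord m) a + Cv n (mcoord d) a.
Proof. by rewrite -CvD; apply: Cv_ext => b _; rewrite mcoordD. Qed.

Lemma Cv_mcoordN m a : Cv n (mcoord (- m)) a = - Cv n (mcoord m) a.
Proof.
transitivity (Cv n (fun b => -1 * mcoord m b) a); last by rewrite CvZ mulN1r.
by apply: Cv_ext => b _; rewrite mcoordN mulN1r.
Qed.

(** This is C C^{-1} = 1; at s = 1 and s = n - 1 it uses the zero boundary values. *)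
Lemma Cv_second_diff f s : (0 < s < n)%N ->
  Cv n f s.-1 - 2%:R * Cv n f s + Cv n f s.+1 = - f s.
Proof.
move=> Hs; rewrite !CvE; try lia.
rewrite mulr_sumr -sumrB -big_split /=.
rewrite (eq_bigr (fun b : 'I_n.-1 => (b.+1 == s)%:R * - f b.+1)) => [|b _].
  by rewrite (big_ord_pick (fun b => - f b)) Hs mul1r.
have -> : s = s.-1.+1 by lia.
move: (s.-1) => t /=.
have E1 := cinv_diff b.+1 t; have E2 := cinv_diff b.+1 t.+1.
rewrite ![cinv _ b.+1]cinvC.
transitivity ((cinv b.+1 t.+2 - cinv b.+1 t.+1 - (cinv b.+1 t.+1 - cinv b.+1 t)) * f b.+1); first by ring.
rewrite E1 E2.
have -> : (t < b.+1)%:R = (t.+1 < b.+1)%:R + (b.+1 == t.+1)%:R :> rat.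
  by rewrite -natrD; congr (_%:R); lia.
by ring.
Qed.

Definition cinv_form (f g : nat -> rat) : rat := \sum_(a < n.-1) f a.+1 * Cv n g a.+1.

Lemma cinv_formC f g : cinv_form f g = cinv_form g f.
Proof.
rewrite /cinv_form.
rewrite (eq_bigr (fun a : 'I_n.-1 => \sum_(b < n.-1) f a.+1 * (cinv a.+1 b.+1 * g b.+1))) => [|a _]; last first.
  by rewrite CvE ?mulr_sumr //; have := ltn_ord a; lia.
rewrite exchange_big; apply: eq_bigr => b _.
rewrite CvE; last by have := ltn_ord b; lia.
by rewrite mulr_sumr; apply: eq_bigr => a _; rewrite cinvC; ring.
Qed.

Lemma cinv_form_unit t g : cinv_form (mcoord (unitv t)) g = ((0 < t < n)%N)%:R * Cv n g t.
Proof.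
rewrite -(big_ord_pick (Cv n g)); apply: eq_bigr => a _.
by rewrite mcoordS ffunE.
Qed.

Lemma Cv0 g : Cv n g 0 = 0.
Proof. by rewrite CvE // big1 // => b _; rewrite cinvC cinv0 mul0r. Qed.

Lemma Cvn g : Cv n g n = 0.
Proof.
by rewrite CvE // big1 // => b _; rewrite cinvC cinvn ?mul0r //; have := ltn_ord b; lia.
Qed.

Lemma cinv_form_unit' t g : (t <= n)%N -> cinv_form (mcoord (unitv t)) g = Cv n g t.
Proof.
move=> tn; rewrite cinv_form_unit; case: (boolP (0 < t < n)%N) => Ht; first by rewrite mul1r.
rewrite mul0r; have [->|tpos] := posnP t; first by rewrite Cv0.
by rewrite (_ : t = n) ?Cvn //; lia.
Qed.

Lemma cinv_form_mcoordD m d g : cinv_form (mcoord (m + d)) g = cinv_form (mcoord m) g + cinv_form (mcoord d) g.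
Proof. by rewrite /cinv_form -big_split; apply: eq_bigr => a _; rewrite mcoordD mulrDl. Qed.

Lemma cinv_form_mcoordN m g : cinv_form (mcoord (- m)) g = - cinv_form (mcoord m) g.
Proof. by rewrite /cinv_form -sumrN; apply: eq_bigr => a _; rewrite mcoordN mulNr. Qed.

(** * Entries of the q-binomial coefficients and the quadratic exponent *)

Variable j : nat.

(* x_a = N_a - m_a; the extra [L] at [a = n] makes the second difference of x
   equal to 2 m_a - (e_r)_a - (e_{n-j})_a for every 0 < a < n *)
Definition nvec (L r : nat) (m : V) (a : nat) : rat :=
  L%:R * (Cv n (ev n.-1) a + (a == n)%:R) + Cv n (ev r) a + Cv n (ev (n - j)) a
  - 2%:R * Cv n (mcoord m) a.

Definition Nvec L r m a : rat := mcoord m a + nvec L r m a.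

Definition quad_exp (m : V) : rat := cinv_form (mcoord m) (mcoord m) - cinv_form (mcoord m) (ev (n - j)).

Lemma nvec_0 L r m : nvec L r m 0 = 0.
Proof.
rewrite /nvec !Cv0 (_ : (0 == n)%N = false); last by lia.
by rewrite /=; ring.
Qed.

Lemma nvec_n L r m : nvec L r m n = L%:R.
Proof. by rewrite /nvec !Cvn eqxx /=; ring. Qed.

Lemma nvec_second_diff L r m s : (0 < s < n)%N ->
  nvec L r m s.-1 - 2%:R * nvec L r m s + nvec L r m s.+1 =
  2%:R * mcoord m s - (s == r)%:R - (s == (n - j)%N)%:R.
Proof.
move=> Hs; rewrite /nvec.
have E1 := Cv_second_diff (ev n.-1) Hs; have E2 := Cv_second_diff (ev r) Hs.
have E3 := Cv_second_diff (ev (n - j)) Hs; have E4 := Cv_second_diff (mcoord m) Hs.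
rewrite /ev in E1 E2 E3.
have F1 : (s.-1 == n)%:R = 0 :> rat by rewrite (_ : (s.-1 == n)%N = false) //; lia.
have F2 : (s == n)%:R = 0 :> rat by rewrite (_ : (s == n)%N = false) //; lia.
have F3 : (s.+1 == n)%:R = (s == n.-1)%:R :> rat by congr (_%:R); lia.
rewrite F1 F2 F3 /ev.
transitivity (L%:R * (Cv n (fun a => (a == n.-1)%:R) s.-1 - 2%:R * Cv n (fun a => (a == n.-1)%:R) s
   + Cv n (fun a => (a == n.-1)%:R) s.+1 + (s == n.-1)%:R)
  + (Cv n (fun a => (a == r)%:R) s.-1 - 2%:R * Cv n (fun a => (a == r)%:R) s
   + Cv n (fun a => (a == r)%:R) s.+1)
  + (Cv n (fun a => (a == (n - j)%N)%:R) s.-1 - 2%:R * Cv n (fun a => (a == (n - j)%N)%:R) s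
   + Cv n (fun a => (a == (n - j)%N)%:R) s.+1)
  - 2%:R * (Cv n (mcoord m) s.-1 - 2%:R * Cv n (mcoord m) s + Cv n (mcoord m) s.+1)); first by ring.
by rewrite E1 E2 E3 E4; ring.
Qed.

Lemma nvecD L r m d a : nvec L r (m + d) a = nvec L r m a - 2%:R * Cv n (mcoord d) a.
Proof. by rewrite /nvec Cv_mcoordD; ring. Qed.

(** The gradient of the exponent, 2 C^{-1} m - C^{-1} e_{n-j}, equals C^{-1} (L e_{n-1} + e_r) - x
    at the indices below n. So L and r may be chosen freely, to match the x of the term being
    translated. *)
Lemma quad_expD L r m d :
  quad_exp (m + d) = quad_exp m + L%:R * cinv_form (mcoord d) (ev n.-1) + cinv_form (mcoord d) (ev r)
    + cinv_form (mcoord d) (mcoord d) - \sum_(a < n.-1) mcoord d a.+1 * nvec L r m a.+1.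
Proof.
have -> : \sum_(a < n.-1) mcoord d a.+1 * nvec L r m a.+1 =
   L%:R * cinv_form (mcoord d) (ev n.-1) + cinv_form (mcoord d) (ev r) + cinv_form (mcoord d) (ev (n - j))
   - 2%:R * cinv_form (mcoord d) (mcoord m).
  rewrite /cinv_form !mulr_sumr -!big_split -sumrB; apply: eq_bigr => a _ /=.
  rewrite /nvec (_ : (a.+1 == n)%N = false) /=; first by ring.
  by have := ltn_ord a; lia.
rewrite /quad_exp !cinv_form_mcoordD ![cinv_form _ (mcoord (m + d))]cinv_formC !cinv_form_mcoordD.
rewrite [cinv_form (mcoord m) (mcoord d)]cinv_formC; ring.
Qed.


Lemma sum_mcoord_unit t (f : nat -> rat) :
  \sum_(a < n.-1) mcoord (unitv t) a.+1 * f a.+1 = ((0 < t < n)%N)%:R * f t.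
Proof. by rewrite -big_ord_pick; apply: eq_bigr => a _; rewrite mcoordS ffunE. Qed.

(** * Products of q-binomial coefficients, Pascal's rule and finite support *)

Definition prodQ (N M : nat -> rat) : {poly rat} :=
  \prod_(i < n.-1) qbin (N i.+1) (M i.+1).

Lemma eq_prodQ N M N' M' :
  (forall a, (0 < a < n)%N -> N a = N' a) -> (forall a, (0 < a < n)%N -> M a = M' a) ->
  prodQ N M = prodQ N' M'.
Proof.
move=> HN HM; apply: eq_bigr => i _.
have Hi : (0 < i.+1 < n)%N by have := ltn_ord i; lia.
by rewrite HN ?HM.
Qed.

Lemma prodQ_pick s N M : (0 < s < n)%N ->
  prodQ N M = qbin (N s) (M s) * \prod_(i < n.-1 | i.+1 != s) qbin (N i.+1) (M i.+1).
Proof.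
move=> Hs; have Hs' : (s.-1 < n.-1)%N by lia.
have sE : s.-1.+1 = s by lia.
rewrite /prodQ (bigD1 (Ordinal Hs')) //= sE; congr (_ * _).
by apply: eq_bigl => i; rewrite -val_eqE /= -eqSS sE.
Qed.

Lemma prodQ_pascal s N M e x : (0 < s < n)%N ->
  ((forall a, (0 < a < n)%N -> a != s -> qbin (N a) (M a) != 0) ->
    N s != 0 \/ M s != 0) ->
  qcoef (e, prodQ N M) x =
  qcoef (e, prodQ (fun a => N a - (a == s)%:R) M) x +
  qcoef (e + (N s - M s),
    prodQ (fun a => N a - (a == s)%:R) (fun a => M a - (a == s)%:R)) x.
Proof.
move=> Hs nz.
pose p := \prod_(i < n.-1 | i.+1 != s) qbin (N i.+1) (M i.+1).
have E0 : prodQ N M = qbin (N s) (M s) * p by exact: prodQ_pick.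
have E1 : prodQ (fun a => N a - (a == s)%:R) M = qbin (N s - 1) (M s) * p.
  rewrite (prodQ_pick _ _ Hs) eqxx; congr (_ * _).
  by apply: eq_bigr => i /negbTE ->; rewrite subr0.
have E2 : prodQ (fun a => N a - (a == s)%:R) (fun a => M a - (a == s)%:R) =
    qbin (N s - 1) (M s - 1) * p.
  rewrite (prodQ_pick _ _ Hs) eqxx; congr (_ * _).
  by apply: eq_bigr => i /negbTE ->; rewrite !subr0.
rewrite E0 E1 E2; apply: qcoef_pascal; case: (eqVneq p 0) => [->|pnz]; [by left|right].
apply: nz => a Ha ne; apply: contra_neq pnz => E.
have Ha' : (a.-1 < n.-1)%N by lia.
have aE : a.-1.+1 = a by lia.
by rewrite /p (bigD1 (Ordinal Ha')) /= aE ?E ?mul0r.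
Qed.

(** Common shape of all terms of the telescoping: [al] is an extra exponent of q, while [dN] and
    [dM] displace the upper and lower entries. *)
Definition shifted_term L r (al : V -> rat) (dN dM : nat -> rat) (m : V) (x : rat) : rat :=
  qcoef (quad_exp m + al m,
    prodQ (fun a => Nvec L r m a + dN a) (fun a => mcoord m a + dM a)) x.

Lemma qcoef_eq e e' p p' x x' :
  p = p' -> x - e = x' - e' -> qcoef (e, p) x = qcoef (e', p') x'.
Proof. by rewrite /qcoef /= => -> ->. Qed.

Lemma shifted_term_shift L r al dN dM L' r' al' dN' dM' d m x x' :
  (forall a, (0 < a < n)%N ->
    Nvec L r (m + d) a + dN a = Nvec L' r' m a + dN' a) ->
  (forall a, (0 < a < n)%N -> mcoord d a + dM a = dM' a) ->
  quad_exp (m + d) + al (m + d) - x = quad_exp m + al' m - x' ->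
  shifted_term L r al dN dM (m + d) x = shifted_term L' r' al' dN' dM' m x'.
Proof.
move=> HN HM He; apply: qcoef_eq; last first.
  by apply: oppr_inj; rewrite !opprB.
by apply: eq_prodQ => a Ha; rewrite ?HN // mcoordD -addrA HM.
Qed.

Lemma shifted_term_ext L r al dN dM L' r' al' dN' dM' m x x' :
  (forall a, (0 < a < n)%N -> Nvec L r m a + dN a = Nvec L' r' m a + dN' a) ->
  (forall a, (0 < a < n)%N -> dM a = dM' a) ->
  al m - x = al' m - x' ->
  shifted_term L r al dN dM m x = shifted_term L' r' al' dN' dM' m x'.
Proof.
move=> HN HM He; apply: qcoef_eq; last first.
  by apply: oppr_inj; rewrite !opprB -!addrA He.
by apply: eq_prodQ => a Ha; rewrite ?HN // HM.
Qed.

(** Nonvanishing of the other factors is weakened to the inequalities upper entry >= lower entry,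
    which is all that the concavity arguments use. *)
Lemma shifted_term_pascal s L r al dN dM m x : (0 < s < n)%N ->
  ((forall a, (0 < a < n)%N -> a != s -> 0 <= nvec L r m a + dN a - dM a) ->
    Nvec L r m s + dN s != 0 \/ mcoord m s + dM s != 0) ->
  shifted_term L r al dN dM m x =
  shifted_term L r al (fun a => dN a - (a == s)%:R) dM m x +
  shifted_term L r (fun m => al m + (nvec L r m s + dN s - dM s))
    (fun a => dN a - (a == s)%:R) (fun a => dM a - (a == s)%:R) m x.
Proof.
move=> Hs nz; rewrite /shifted_term (prodQ_pascal _ _ Hs); last first.
  move=> H; apply: nz => a Ha ne.
  have [mm [d [EM EN]]] := qbin_neq0P (H a Ha ne).
  rewrite (_ : _ - _ = d%:R) //; move: EN EM; rewrite /Nvec natrD => EN EM.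
  by apply: (addrI mm%:R); rewrite -EN -EM; ring.
congr (_ + _); apply: qcoef_eq; try by congr (_ - _); rewrite /Nvec; ring.
  by apply: eq_prodQ => a _ //; rewrite addrA.
  by apply: eq_prodQ => a _ //; rewrite addrA.
Qed.

Lemma cinv1_ge b : (0 < b < n)%N -> n%:R^-1 <= cinv 1 b.
Proof.
move=> Hb; have npos : (0 : rat) < n%:R by rewrite ltr0n; lia.
rewrite /cinv (_ : minn 1 b = 1%N); last by lia.
rewrite mul1r lerBrDr -[X in X + _]mul1r -mulrDl ler_pdivrMr // mul1r.
by rewrite addrC natr1 ler_nat; lia.
Qed.

Lemma finite_box (K : nat) :
  finite_set [set m : V | forall i, (-2 <= m i <= K%:Z)%R].
Proof.
(* The K + 3 values are -2, ..., K. *)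
pose h (f : {ffun 'I_n.-1 -> 'I_K.+3}) : V := [ffun i => (f i : nat)%:Z - 2].
apply: (@sub_finite_set _ _ (h @` setT)%classic); last first.
  apply: finite_image; exact: finite_finset.
move=> m /= Hm.
exists [ffun i => inord (absz (m i + 2)) : 'I_K.+3] => //.
apply/ffunP => i; rewrite !ffunE /=; have := Hm i => /andP [m1 m2].
rewrite inordK; lia.
Qed.

Lemma shifted_term_neq0 L r al dN dM m x a : shifted_term L r al dN dM m x != 0 -> (0 < a < n)%N ->
  (exists k : nat, mcoord m a + dM a = k%:R) /\ 0 <= nvec L r m a + dN a - dM a.
Proof.
move=> nz Ha; have : prodQ (fun a => Nvec L r m a + dN a) (fun a => mcoord m a + dM a) != 0.
  by apply: contra_neq nz => E; rewrite /shifted_term E qcoef0.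
rewrite (prodQ_pick _ _ Ha) mulf_eq0 negb_or => /andP [].
move=> /qbin_neq0P [mm [d [EM EN]]] _; split; first by exists mm.
rewrite (_ : _ - _ = d%:R) //; move: EN EM; rewrite /Nvec natrD => EN EM.
by apply: (addrI mm%:R); rewrite -EN -EM; ring.
Qed.

(** A lower bound on x_1 bounds (C^{-1} m)_1 from above. This linear form has coefficients at least
    1/n and the m_b are at least -2, so every m_b is bounded. The constants 2 and 3 leave room for
    all displacements that occur. *)
Lemma fsupp_shifted_term L r al dN dM x :
  (forall a, (0 < a < n)%N -> dM a <= 2 /\ -3%:R <= dM a - dN a) ->
  fsupp (fun m => shifted_term L r al dN dM m x).
Proof.
move=> Hd.
pose c0 := L%:R * Cv n (ev n.-1) 1 + Cv n (ev r) 1 + Cv n (ev (n - j)) 1.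
pose c1 := \sum_(b < n.-1) cinv 1 b.+1 * 2.
pose K := Num.bound (`|(c0 + 3%:R + 2%:R * c1) * n%:R|).
apply: fsuppS (finite_box K) _ => m nz i.
have Hpos (a : nat) : (0 < a < n)%N ->
    (exists k : nat, mcoord m a + dM a = k%:R) /\ 0 <= nvec L r m a + dN a - dM a.
  exact: shifted_term_neq0 nz.
have mge (b : 'I_n.-1) : -2 <= (m b)%:~R :> rat.
  have Hb : (0 < b.+1 < n)%N by have := ltn_ord b; lia.
  have [[k Ek] _] := Hpos _ Hb; have [d2 _] := Hd _ Hb.
  have : (0 : rat) <= k%:R by []; rewrite -Ek mcoordS.
  by move: (m b)%:~R d2 => u; lra.
have H1 : (0 < 1 < n)%N by lia.
have [_ x1] := Hpos _ H1; have [_ d1] := Hd _ H1.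
have {}x1 : - 3%:R <= nvec L r m 1 by move: x1 d1; lra.
(* Adding 2 to every m_b makes all summands nonnegative, so that a bound on the sum bounds each of
   them. *)
have sumle : \sum_(b < n.-1) cinv 1 b.+1 * ((m b)%:~R + 2) <= c0 + 3%:R + 2%:R * c1.
  have -> : \sum_(b < n.-1) cinv 1 b.+1 * ((m b)%:~R + 2) = Cv n (mcoord m) 1 + c1.
    rewrite CvE /c1 -?big_split /=; last by lia.
    by apply: eq_bigr => b _; rewrite mcoordS mulrDr.
  have E : nvec L r m 1 = c0 - 2%:R * Cv n (mcoord m) 1.
    rewrite /nvec /c0 (_ : (1 == n)%N = false) /=; last by lia.
    by rewrite addr0.
  have c1ge : 0 <= c1.
    apply: sumr_ge0 => b _; rewrite mulr_ge0 //.
    apply: le_trans (cinv1_ge (_ : (0 < b.+1 < n)%N)); last by have := ltn_ord b; lia.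
    by rewrite invr_ge0.
  have Cge : - c1 <= Cv n (mcoord m) 1.
    rewrite CvE /c1 -?sumrN; last by lia.
    apply: ler_sum => b _; rewrite mcoordS -mulrN ler_wpM2l //.
    apply: le_trans (cinv1_ge (_ : (0 < b.+1 < n)%N)); last by have := ltn_ord b; lia.
    by rewrite invr_ge0.
  by move: x1; rewrite E; lra.
have termge (b : 'I_n.-1) : 0 <= cinv 1 b.+1 * ((m b)%:~R + 2).
  rewrite mulr_ge0 //; last by have := mge b; move: (m b)%:~R => u; lra.
  apply: le_trans (cinv1_ge (_ : (0 < b.+1 < n)%N)); last by have := ltn_ord b; lia.
  by rewrite invr_ge0.
have {}sumle : cinv 1 i.+1 * ((m i)%:~R + 2) <= c0 + 3%:R + 2%:R * c1.
  apply: le_trans sumle; rewrite (bigD1 i) //= lerDl.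
  by apply: sumr_ge0 => b _.
have npos : (0 : rat) < n%:R by rewrite ltr0n; lia.
have cci := cinv1_ge (_ : (0 < i.+1 < n)%N).
have {}cci : n%:R^-1 <= cinv 1 i.+1 by apply: cci; have := ltn_ord i; lia.
have mi2 : 0 <= (m i)%:~R + 2 :> rat by have := mge i; move: (m i)%:~R => u; lra.
have ub : (m i)%:~R + 2 <= (c0 + 3%:R + 2%:R * c1) * n%:R.
  rewrite -ler_pdivrMr //; apply: le_trans sumle.
  by rewrite mulrC ler_wpM2r.
have Kge : (c0 + 3%:R + 2%:R * c1) * n%:R <= K%:R.
  by apply: le_trans (ler_norm _) _; apply: ltW; apply: Num.Theory.archi_boundP.
apply/andP; split.
  by rewrite -(ler_int rat); exact: mge.
rewrite -(ler_int rat); apply: le_trans Kge; apply: le_trans ub.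
by rewrite lerDl.
Qed.


(** * Sums over a class of the lattice, and the terms of the telescoping *)

Definition dom (k : nat) (m : V) : bool :=
  k%:R / n%:R + Cv n (mcoord m) n.-1 \is a Num.int.

Definition dom_sum k (f : V -> rat) : rat := fsum (fun m => (dom k m)%:R * f m).

Lemma fsupp_dom k f : fsupp f -> fsupp (fun m => (dom k m)%:R * f m).
Proof.
move=> ff; apply: fsuppS ff _ => m /=.
by apply: contra_neq => ->; rewrite mulr0.
Qed.

Lemma dom_sum_add k f g h : fsupp f -> fsupp g ->
  (forall m, h m = f m + g m) -> dom_sum k h = dom_sum k f + dom_sum k g.
Proof.
move=> ff fg E; rewrite /dom_sum -fsumD; try exact: fsupp_dom.
by congr (fsum _); apply/funext => m; rewrite E mulrDr.
Qed.

Lemma eq_dom_sum k f g : (forall m, f m = g m) -> dom_sum k f = dom_sum k g.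
Proof. by move=> E; congr (fsum _); apply/funext => m; rewrite E. Qed.

Lemma dom_sum_shift k k' d f :
  (forall m, dom k (m + d) = dom k' m) ->
  dom_sum k f = dom_sum k' (fun m => f (m + d)).
Proof.
move=> Hd; rewrite /dom_sum (@fsum_bij _ _ (fun m => m + d)).
  by congr (fsum _); apply/funext => m; rewrite Hd.
by exists (fun m => m - d) => m; rewrite ?addrK ?subrK.
Qed.

(* Pascal's rule at the factor s turns [Uterm s.+1] into [Uterm s + Dterm s];
   at the factor s + 1 it turns [Tterm s] into [Dterm s + Tshift s], and [Tshift s]
   becomes [Tterm s.+1] after a translation of m by [cartan s.+1]. *)
Definition Uterm L r s := shifted_term L r (fun _ => 0) (fun a => - (s <= a)%:R) (fun _ => 0).

Definition Dterm L r s := shifted_term L r (fun m => nvec L r m s)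
  (fun a => - (s <= a)%:R) (fun a => - (a == s)%:R).

Definition Tterm L r s := shifted_term L r (fun m => 1 + nvec L r m s - nvec L r m s.+1)
  (fun a => - (a == s)%:R - (s.+2 <= a)%:R) (fun a => (a == s.+1)%:R - (a == s)%:R).

Definition Tshift L r s := shifted_term L r (fun m => 1 + nvec L r m s - nvec L r m s.+1)
  (fun a => - (a == s)%:R - (s < a)%:R) (fun a => (a == s.+1)%:R - (a == s)%:R).

Lemma fsupp_Uterm L r s x : fsupp (fun m => Uterm L r s m x).
Proof. by apply: fsupp_shifted_term => a _; case: leqP => _; split; rewrite /=; lra. Qed.

Lemma fsupp_Dterm L r s x : fsupp (fun m => Dterm L r s m x).
Proof. by apply: fsupp_shifted_term => a _; case: leqP; case: eqP => _ _; split; rewrite /=; lra. Qed.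

Lemma fsupp_Tshift L r s x : fsupp (fun m => Tshift L r s m x).
Proof.
by apply: fsupp_shifted_term => a _; case: (s < a)%N; case: (a == s); case: (a == s.+1); split; rewrite /=; lra.
Qed.

Lemma Uterm_step L r s m x : (0 < s < n)%N ->
  Uterm L.+1 r s.+1 m x = Uterm L.+1 r s m x + Dterm L.+1 r s m x.
Proof.
move=> Hs; rewrite {1}/Uterm (shifted_term_pascal (s := s)) //.
  have E a : - (s < a)%:R - (a == s)%:R = - (s <= a)%:R :> rat.
    by rewrite -opprD -natrD; congr (- _%:R); lia.
  congr (_ + _).
    by apply: shifted_term_ext => // a _; rewrite E.
  apply: shifted_term_ext => [a _|a _|]; rewrite ?E ?sub0r //.
  by rewrite ltnn /=; ring.
(* Pascal's rule only fails for N_s = m_s = 0; then x_s = 0, while nonvanishing of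
   the other factors gives x_(s-1) >= 0 and x_(s+1) >= 1, but m_s = 0 makes x
   concave at s. *)
move=> H; apply/orP; rewrite -negb_and; apply/negP => /andP [/eqP EN /eqP EM].
have x0 : 0 <= nvec L.+1 r m s.-1.
  have [->|ne] := eqVneq s.-1 0%N; first by rewrite nvec_0.
  have /H : (0 < s.-1 < n)%N by lia.
  by rewrite (_ : (s < s.-1)%N = false) /=; [rewrite oppr0 addr0 subr0; apply; lia | lia].
have x1 : 1 <= nvec L.+1 r m s.+1.
  have [->|ne] := eqVneq s.+1 n; first by rewrite nvec_n ler1n.
  have /H : (0 < s.+1 < n)%N by lia.
  by rewrite ltnSn /= subr0 subr_ge0; apply; lia.
have := nvec_second_diff L.+1 r m Hs.
move: EN EM; rewrite /Nvec ltnn /= oppr0 !addr0 => EN EM; rewrite EM add0r in EN.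
have p1 : (0 : rat) <= (s == r)%:R by [].
have p2 : (0 : rat) <= (s == (n - j)%N)%:R by [].
by rewrite EN EM; move: p1 p2 x0 x1; lra.
Qed.

Lemma Tterm_step L r s m x : (0 < s)%N -> (s.+1 < n)%N ->
  Tterm L.+1 r s m x = Dterm L.+1 r s m x + Tshift L.+1 r s m x.
Proof.
move=> s0 s1; have Hs : (0 < s.+1 < n)%N by lia.
rewrite {1}/Tterm (shifted_term_pascal (s := s.+1)) // 1?addrC.
  have E a : - (a == s)%:R - (s.+1 < a)%:R - (a == s.+1)%:R =
      - (a == s)%:R - (s < a)%:R :> rat.
    by rewrite -!opprD -!natrD; congr (- _%:R); lia.
  congr (_ + _); last first.
    by apply: shifted_term_ext => // a _; rewrite E.
  apply: shifted_term_ext => [a _|a _|].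
  - by rewrite E -opprD -natrD; congr (_ - _%:R); lia.
  - by ring.
  have b4 : (s.+1 == s)%N = false by lia.
  by rewrite ltnn (eqxx s.+1) b4 /=; ring.
(* The exceptional entry now means m_{s+1} = -1 and x_{s+1} = 1. The other factors give x_s >= 0 and
   x_{s+2} >= 1, but the second difference at s + 1 forces x_s + x_{s+2} <= 0. *)
move=> H; apply/orP; rewrite -negb_and; apply/negP => /andP [/eqP EN /eqP EM].
have x0 : 0 <= nvec L.+1 r m s.
  have /H : (0 < s < n)%N by lia.
  have b1 : (s.+1 < s)%N = false by lia.
  have b2 : (s == s.+1)%N = false by lia.
  have b3 : (s != s.+1)%N by lia.
  move=> /(_ b3); rewrite b1 b2 (eqxx s) /=; move: (nvec _ _ _ _) => u; lra.
have x1 : 1 <= nvec L.+1 r m s.+2.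
  have [->|ne] := eqVneq s.+2 n; first by rewrite nvec_n ler1n.
  have /H : (0 < s.+2 < n)%N by lia.
  have b1 : (s.+1 < s.+2)%N by lia.
  have b2 : (s.+2 == s.+1)%N = false by lia.
  have b3 : (s.+2 != s.+1)%N by lia.
  have b4 : (s.+2 == s)%N = false by lia.
  move=> /(_ b3); rewrite b1 b2 b4 /=; move: (nvec _ _ _ _) => u; lra.
have /= := nvec_second_diff L.+1 r m Hs.
have b4 : (s.+1 == s)%N = false by lia.
move: EN EM; rewrite /Nvec ltnn (eqxx s.+1) b4 /=.
have p1 : (0 : rat) <= (s.+1 == r)%:R by [].
have p2 : (0 : rat) <= (s.+1 == (n - j)%N)%:R by [].
by move: p1 p2 x0 x1; lra.
Qed.

(** Here x_{s+1} = x_n = L + 1 is constant, so the exponent is that of [Dterm] less L: this is the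
    origin of the factor q^L. *)
Lemma Tterm_last L r s m x : s.+1 = n ->
  Tterm L.+1 r s m x = Dterm L.+1 r s m (x + L%:R).
Proof.
move=> sn; apply: shifted_term_ext => [a Ha|a Ha|].
- by rewrite -opprD -natrD; congr (_ - _%:R); lia.
- by rewrite (_ : (a == s.+1) = false) ?sub0r //; lia.
by rewrite sn nvec_n -natr1; ring.
Qed.


(** * The fermionic recurrences *)

Definition fermi_term L r := shifted_term L r (fun _ => 0) (fun _ => 0) (fun _ => 0).

Definition fermi k L r x := dom_sum k (fun m => fermi_term L r m x).

Lemma cinv_n1 a : (a < n)%N -> cinv a n.-1 = a%:R / n%:R.
Proof.
move=> an; have := cinv_diff a n.-1; rewrite prednK; last by lia.
rewrite cinvn ?(ltnW an) // (_ : (n <= a)%N = false) /=; last by lia.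
by move=> E; apply: oppr_inj; move: E; rewrite !sub0r.
Qed.

Lemma nvec_lt L r m a : (r <= n)%N -> (a < n)%N ->
  nvec L r m a = L%:R * (a%:R / n%:R) + cinv a r + Cv n (ev (n - j)) a - 2%:R * Cv n (mcoord m) a.
Proof.
move=> rn an; rewrite /nvec (Cv_ev rn (ltnW an)) (@Cv_ev n.-1 a _ (ltnW an)); last by lia.
rewrite (cinv_n1 an) (_ : (a == n)%N = false) /=; last by lia.
by rewrite addr0.
Qed.

(** By [cinv_diff], passing from (L, r - 1) to (L + 1, r) raises the upper entries by 1 exactly at a
    >= r, and [Uterm] takes this back. *)
Lemma fermi_term_pred L r m x : (0 < r <= n)%N ->
  fermi_term L r.-1 m x = Uterm L.+1 r r m x.
Proof.
move=> Hr; apply: shifted_term_ext => // a Ha.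
have E := cinv_diff a r.-1; rewrite prednK in E; last by lia.
rewrite /Nvec !nvec_lt; try lia.
have {}E : cinv a r.-1 = cinv a r - (r <= a)%:R + a%:R / n%:R.
  by move: E; move: (cinv a r) (cinv a r.-1) (_ <= _)%:R (a%:R / n%:R) => u v w z; lra.
by rewrite E -natr1; ring.
Qed.

Lemma Uterm_n L r m x : Uterm L r n m x = fermi_term L r m x.
Proof.
apply: shifted_term_ext => // a Ha; rewrite (_ : (n <= a)%N = false) ?oppr0 //; lia.
Qed.

Lemma quad_exp_shift_unit L r t m : (0 < t < n)%N -> (r <= n)%N ->
  quad_exp (m - unitv t) = quad_exp m - L%:R * (t%:R / n%:R) - cinv t r + cinv t t + nvec L r m t.
Proof.
move=> Ht rn; rewrite (quad_expD L r) !cinv_form_mcoordN !cinv_form_unit' ?Cv_mcoordN ?Cv_mcoord_unit ?Cv_ev; try lia.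
rewrite cinv_n1; last by lia.
rewrite (eq_bigr (fun a : 'I_n.-1 => mcoord (unitv t) a.+1 * - nvec L r m a.+1)) => [|a _].
  by rewrite (sum_mcoord_unit t (fun a => - nvec L r m a)) Ht mul1r; ring.
by rewrite mcoordN mulNr mulrN.
Qed.

Lemma natr_predn : n.-1%:R = n%:R - 1 :> rat.
Proof. by rewrite -subn1 natrB //; lia. Qed.

(** A second reading of the end term of the chain, as a translate of a summand two levels below: the
    telescoping closes within the family of fermionic sums. *)
Lemma fermi_term_last L r m x : (r < n)%N ->
  fermi_term L r (m - unitv n.-1) (x - (r%:R - L.+1%:R) / n%:R) =
  Tterm L.+2 r n.-1 m x.
Proof.
move=> rn; have nn1 : (0 < n.-1 < n)%N by lia.
have nE : n.-1.+1 = n by lia.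
apply: shifted_term_shift => [a Ha|a Ha|].
- rewrite /Nvec mcoordD mcoordN mcoord_unit Ha /= nE !nvec_lt; try lia.
  rewrite Cv_mcoordD Cv_mcoordN Cv_mcoord_unit; try lia.
  rewrite cinv_n1; last by lia.
  rewrite (_ : (n < a)%N = false); last by lia.
  by rewrite -!natr1 /=; ring.
- rewrite mcoordN mcoord_unit Ha nE (_ : (a == n) = false) /=; last by lia.
  by rewrite addr0 sub0r.
rewrite (quad_exp_shift_unit L.+2 _ nn1 (ltnW rn)) nE nvec_n.
rewrite [cinv n.-1 r]cinvC !cinv_n1; try lia.
rewrite natr_predn -!natr1; have nz := n_neq0.
by field.
Qed.

(** C^{-1} (e_{r+1} - e_r) is a step function minus the slope a/n. It enters once through r and -2
    times through m; the net slope a/n raises the level by 1, and the net step lowers the upper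
    entries beyond r. *)
Lemma fermi_term_up L r m x : (0 < r < n)%N ->
  fermi_term L r.+1 (m + unitv r.+1 - unitv r) (x - (r%:R - L%:R) / n%:R) =
  Tterm L.+1 r r m x.
Proof.
move=> Hr; rewrite -addrA; pose d := unitv r.+1 - unitv r.
have mzd a : (0 < a < n)%N -> mcoord d a = (a == r.+1)%:R - (a == r)%:R.
  by move=> Ha; rewrite mcoordD mcoordN !mcoord_unit Ha.
have Cvd a : (a <= n)%N -> Cv n (mcoord d) a = (r < a)%:R - a%:R / n%:R.
  by move=> Ha; rewrite Cv_mcoordD Cv_mcoordN !Cv_mcoord_unit -?cinv_diff; try lia.
apply: shifted_term_shift => [a Ha|a Ha|].
- rewrite /Nvec mcoordD mzd // !nvec_lt; try lia.
  rewrite Cv_mcoordD Cvd; last by lia.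
  have E := cinv_diff a r.
  have {}E : cinv a r.+1 = cinv a r + (r < a)%:R - a%:R / n%:R.
    by move: E; move: (cinv a r) (cinv a r.+1) (_ < _)%:R (a%:R / n%:R) => u v w z; lra.
  have -> : (r.+1 < a)%:R = (r < a)%:R - (a == r.+1)%:R :> rat.
    rewrite (_ : (r < a)%:R = (r.+1 < a)%:R + (a == r.+1)%:R) ?addrK //.
    by rewrite -natrD; congr (_%:R); lia.
  by rewrite E -natr1; ring.
- by rewrite mzd // addr0.
(* The correction at r + 1 = n is due to [unitv n] being 0 although x_n = L + 1 is not. *)
have dsum : \sum_(a < n.-1) mcoord d a.+1 * nvec L.+1 r m a.+1 =
    nvec L.+1 r m r.+1 - (r.+1 == n)%:R * L.+1%:R - nvec L.+1 r m r.
  rewrite (eq_bigr (fun a : 'I_n.-1 => mcoord (unitv r.+1) a.+1 * nvec L.+1 r m a.+1 -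
     mcoord (unitv r) a.+1 * nvec L.+1 r m a.+1)) => [|a _]; last first.
    by rewrite mcoordD mcoordN mulrBl.
  rewrite sumrB !sum_mcoord_unit Hr mul1r; congr (_ - _).
  have [E|ne] := eqVneq r.+1 n; first by rewrite E nvec_n ltnn andbF /=; ring.
  by rewrite (_ : (0 < r.+1 < n)%N) /=; [ring | lia].
rewrite (quad_expD L.+1 r) dsum !cinv_form_mcoordD !cinv_form_mcoordN !cinv_form_unit' ?Cvd ?Cv_ev; try lia.
have E1 : cinv r.+1 n.-1 = r.+1%:R / n%:R - (r.+1 == n)%:R.
  have [->|ne] := eqVneq r.+1 n; last by rewrite cinv_n1 ?subr0 //; lia.
  by rewrite cinvC cinvn ?divff ?subrr ?n_neq0 //; lia.
have E2 : cinv r.+1 r - cinv r r = - (r%:R / n%:R).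
  by rewrite [cinv r.+1 r]cinvC cinv_diff ltnn sub0r.
rewrite E1 E2 cinv_n1; last by lia.
rewrite ltnSn ltnn -!natr1 /=; move: (r.+1 == n)%:R => b.
by have nz := n_neq0; field.
Qed.

Lemma eq_int (a b : rat) :
  a - b \is a Num.int -> (a \is a Num.int) = (b \is a Num.int).
Proof. by move=> H; rewrite -[a](subrK b) rpredDl. Qed.

(** [dom k] says that n divides k + sum_b b m_b, and this translation raises the sum by 1. For r + 1
    = n the vector [unitv n] vanishes and the change is 1 - n. *)
Lemma dom_up k r m : (0 < r < n)%N -> dom k (m + unitv r.+1 - unitv r) = dom k.+1 m.
Proof.
move=> Hr; rewrite /dom -addrA Cv_mcoordD Cv_mcoordD Cv_mcoordN !Cv_mcoord_unit; try lia.
rewrite cinvC [cinv _ r]cinvC.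
have -> : cinv r n.-1 = r%:R / n%:R by rewrite cinv_n1 //; lia.
have -> : cinv r.+1 n.-1 = r.+1%:R / n%:R - (r.+1 == n)%:R.
  have [->|ne] := eqVneq r.+1 n; last by rewrite cinv_n1 ?subr0 //; lia.
  by rewrite cinvC cinvn ?divff ?subrr ?n_neq0 //; lia.
apply: eq_int; rewrite -!natr1; move: (r.+1 == n) => b.
rewrite (_ : _ - _ = - b%:R) ?rpredN ?rpred_nat //.
by have nz := n_neq0; field.
Qed.

Lemma dom_last k m : dom k (m - unitv n.-1) = dom k.+1 m.
Proof.
rewrite /dom Cv_mcoordD Cv_mcoordN Cv_mcoord_unit ?cinv_n1; try lia.
apply: eq_int; rewrite natr_predn -!natr1 (_ : _ - _ = - 1) ?rpredN ?rpred1 //.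
by have nz := n_neq0; field.
Qed.

(* - C e_t: this translation changes x by 2 in the coordinate t only *)
Definition cartan t : V := unitv t.-1 - unitv t - unitv t + unitv t.+1.

Lemma mcoord_cartan t a : (0 < t < n)%N -> (0 < a < n)%N ->
  mcoord (cartan t) a = (a == t.-1)%:R - 2%:R * (a == t)%:R + (a == t.+1)%:R.
Proof. by move=> Ht Ha; rewrite !mcoordD !mcoordN !mcoord_unit Ha /=; ring. Qed.

Lemma Cv_cartan t a : (0 < t < n)%N -> (a <= n)%N ->
  Cv n (mcoord (cartan t)) a = - (a == t)%:R.
Proof.
move=> Ht Ha; rewrite !Cv_mcoordD !Cv_mcoordN !Cv_mcoord_unit; try lia.
have E1 := cinv_diff a t.-1; have E2 := cinv_diff a t.
rewrite prednK in E1; last by lia.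
have E3 : (t <= a)%:R = (t < a)%:R + (a == t)%:R :> rat.
  by rewrite -natrD; congr (_%:R); lia.
rewrite E3 in E1.
by move: E1 E2; move: (cinv a _) (cinv a _) (cinv a _) (_ < _)%:R (a%:R / _) (a == t)%:R => *; lra.
Qed.

Lemma dom_cartan k t m : (0 < t < n)%N -> dom k (m + cartan t) = dom k m.
Proof.
move=> Ht; rewrite /dom Cv_mcoordD Cv_cartan //; last by lia.
by apply: eq_int; rewrite (_ : _ - _ = - (n.-1 == t)%:R) ?rpredN ?rpred_nat //; ring.
Qed.

Lemma Tterm'_shift L r s m x : (0 < s)%N -> (s.+1 < n)%N -> (r <= s)%N ->
  Tshift L.+1 r s (m + cartan s.+1) x = Tterm L.+1 r s.+1 m x.
Proof.
move=> s0 s1 rs; have Hs : (0 < s.+1 < n)%N by lia.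
apply: shifted_term_shift => [a Ha|a Ha|].
- rewrite /Nvec mcoordD mcoord_cartan // nvecD Cv_cartan //=; last by lia.
  have -> : (s < a)%:R = (a == s.+1)%:R + (a == s.+2)%:R + (s.+2 < a)%:R :> rat.
    by rewrite -!natrD; congr (_%:R); lia.
  by ring.
- by rewrite mcoord_cartan //=; ring.
have dsum : \sum_(a < n.-1) mcoord (cartan s.+1) a.+1 * nvec L.+1 r m a.+1 =
    nvec L.+1 r m s - 2%:R * nvec L.+1 r m s.+1 + nvec L.+1 r m s.+2 - (s.+2 == n)%:R * L.+1%:R.
  rewrite (eq_bigr (fun a : 'I_n.-1 => mcoord (unitv s) a.+1 * nvec L.+1 r m a.+1 -
     2%:R * (mcoord (unitv s.+1) a.+1 * nvec L.+1 r m a.+1) +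
     mcoord (unitv s.+2) a.+1 * nvec L.+1 r m a.+1)) => [|a _]; last first.
    by rewrite !mcoordD !mcoordN /=; ring.
  rewrite big_split sumrB /= -mulr_sumr !sum_mcoord_unit Hs (_ : (0 < s < n)%N); last by lia.
  rewrite !mul1r.
  have [E|ne] := eqVneq s.+2 n; first by rewrite E nvec_n ltnn andbF /=; ring.
  by rewrite (_ : (0 < s.+2 < n)%N) /=; [ring | lia].
rewrite (quad_expD L.+1 r) dsum !nvecD.
have bE g : cinv_form (mcoord (cartan s.+1)) g = - g s.+1.
  rewrite !cinv_form_mcoordD !cinv_form_mcoordN !cinv_form_unit' /=; try lia.
  by rewrite -(Cv_second_diff g Hs) /=; ring.
rewrite !bE !Cv_cartan // ?mcoord_cartan //; try lia.
rewrite /ev (_ : (s.+1 == n.-1) = (s.+2 == n)); last by lia.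
(* The exponent would pick up a contribution of e_r at s + 1 = r; for this reason the chain of the
   [Tterm] starts at s = r. *)
rewrite (_ : (s.+1 == r) = false); last by lia.
have b1 : (s == s.+1)%N = false by lia.
have b2 : (s.+1 == s)%N = false by lia.
have b3 : (s.+1 == s.+2)%N = false by lia.
by rewrite /= (eqxx s.+1) b1 b2 b3 /=; ring.
Qed.

Lemma dom_sum_T L k r s x : (r <= s)%N -> (0 < s)%N -> (s.+1 < n)%N ->
  dom_sum k (fun m => Tterm L.+1 r s m x) =
  dom_sum k (fun m => Dterm L.+1 r s m x) + dom_sum k (fun m => Tterm L.+1 r s.+1 m x).
Proof.
move=> rs s0 s1; rewrite (@dom_sum_add k _ _ _ (fsupp_Dterm L.+1 r s x) (fsupp_Tshift L.+1 r s x)); last first.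
  by move=> m; exact: Tterm_step.
congr (_ + _); rewrite (@dom_sum_shift k k (cartan s.+1)); last first.
  by move=> m; apply: dom_cartan; lia.
by apply: eq_dom_sum => m; rewrite Tterm'_shift.
Qed.

Lemma dom_sum_U L k r s x : (0 < s < n)%N ->
  dom_sum k (fun m => Uterm L.+1 r s.+1 m x) =
  dom_sum k (fun m => Uterm L.+1 r s m x) + dom_sum k (fun m => Dterm L.+1 r s m x).
Proof.
move=> Hs; rewrite (@dom_sum_add k _ _ _ (fsupp_Uterm L.+1 r s x) (fsupp_Dterm L.+1 r s x)) //.
by move=> m; exact: Uterm_step.
Qed.

Lemma fermi_rec_aux L k r x : (0 < r < n)%N ->
  fermi k.+1 L.+1 r x =
  fermi k.+1 L r.-1 x + fermi k L r.+1 (x - (r%:R - L%:R) / n%:R)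
  + dom_sum k.+1 (fun m => Tterm L.+1 r n.-1 m (x - L%:R))
  - dom_sum k.+1 (fun m => Tterm L.+1 r n.-1 m x).
Proof.
move=> Hr.
have -> : fermi k.+1 L.+1 r x = dom_sum k.+1 (fun m => Uterm L.+1 r n m x).
  by apply: eq_dom_sum => m; rewrite Uterm_n.
have -> : fermi k.+1 L r.-1 x = dom_sum k.+1 (fun m => Uterm L.+1 r r m x).
  by apply: eq_dom_sum => m; rewrite fermi_term_pred //; lia.
have -> : fermi k L r.+1 (x - (r%:R - L%:R) / n%:R) = dom_sum k.+1 (fun m => Tterm L.+1 r r m x).
  rewrite /fermi (@dom_sum_shift k k.+1 (unitv r.+1 - unitv r)); last first.
    by move=> m; rewrite addrA dom_up.
  by apply: eq_dom_sum => m; rewrite addrA fermi_term_up.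
have -> : dom_sum k.+1 (fun m => Tterm L.+1 r n.-1 m (x - L%:R)) =
    dom_sum k.+1 (fun m => Dterm L.+1 r n.-1 m x).
  by apply: eq_dom_sum => m; rewrite Tterm_last ?subrK //; lia.
(* At each step [Uterm] gains and [Tterm] loses the same [Dterm], so their sum at equal index is
   constant. As [Tterm] stops at n - 1 while [Uterm] goes on to n, one [Dterm] is left over. *)
have key d : (r + d < n)%N ->
    dom_sum k.+1 (fun m => Uterm L.+1 r (r + d).+1 m x) + dom_sum k.+1 (fun m => Tterm L.+1 r (r + d) m x) =
    dom_sum k.+1 (fun m => Uterm L.+1 r r m x) + dom_sum k.+1 (fun m => Tterm L.+1 r r m x) +
    dom_sum k.+1 (fun m => Dterm L.+1 r (r + d) m x).
  elim: d => [|d IH] Hd.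
    by rewrite addn0 dom_sum_U //; ring.
  rewrite dom_sum_U; last by lia.
  move: (IH ltac:(lia)); rewrite [in X in X -> _]dom_sum_T; try lia.
  by rewrite addnS => E; lra.
have := key (n.-1 - r)%N ltac:(lia).
rewrite (_ : (r + (n.-1 - r))%N = n.-1); last by lia.
by rewrite prednK; [lra | lia].
Qed.

(** At L = 0 the two end terms are taken at the same exponent and cancel. *)
Lemma fermi_rec0 k r x : (0 < r < n)%N ->
  fermi k.+1 1 r x = fermi k.+1 0 r.-1 x + fermi k 0 r.+1 (x - r%:R / n%:R).
Proof. by move=> Hr; rewrite fermi_rec_aux // !subr0 addrK. Qed.

Lemma fermi_recS L k r x : (0 < r < n)%N ->
  let y := x - (r%:R - L.+1%:R) / n%:R in
  fermi k.+1 L.+2 r x = fermi k.+1 L.+1 r.-1 x + fermi k L.+1 r.+1 y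
    + fermi k L r (y - L.+1%:R) - fermi k L r y.
Proof.
move=> Hr y; rewrite fermi_rec_aux // -/y.
have E z : dom_sum k.+1 (fun m => Tterm L.+2 r n.-1 m z) = fermi k L r (z - (r%:R - L.+1%:R) / n%:R).
  rewrite /fermi (@dom_sum_shift k k.+1 (- unitv n.-1)); last by move=> m; rewrite dom_last.
  by apply: eq_dom_sum => m; rewrite fermi_term_last //; lia.
by rewrite !E (addrAC x).
Qed.

(** As e_n = 0, one of the L + 1 copies of e_{n-1} can play the part of e_r with r = n - 1. *)
Lemma fermi_n L k x : fermi k L.+1 n x = fermi k L n.-1 x.
Proof.
apply: eq_dom_sum => m; apply: shifted_term_ext => // a Ha; rewrite /Nvec !nvec_lt ?cinvn ?cinv_n1; try lia.
by rewrite -natr1; ring.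
Qed.

Lemma fermi_0n L k x : fermi k L 0 x = fermi k L n x.
Proof.
by apply: eq_dom_sum => m; apply: shifted_term_ext => // a Ha; rewrite /Nvec !nvec_lt ?cinvn ?cinv0; try lia.
Qed.

Lemma fermi_addn L k r x : fermi (k + n) L r x = fermi k L r x.
Proof.
congr (fsum _); apply/funext => m; congr (_%:R * _); congr nat_of_bool.
apply: eq_int; rewrite natrD (_ : _ - _ = 1) ?rpred1 //.
by have nz := n_neq0; field.
Qed.


(** * The fermionic sums for L = 0 *)

Lemma cinv_1 b : cinv 1 b = (0 < b)%:R - b%:R / n%:R.
Proof. by rewrite /cinv mul1r; congr (_%:R - _); lia. Qed.

Lemma cinv_pred b : (b <= n)%N -> cinv n.-1 b = b%:R / n%:R - (b == n)%:R.
Proof.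
have [->|ne] := eqVneq b n; first by rewrite cinvn ?divff ?subrr ?n_neq0 //; lia.
by move=> bn; rewrite cinvC cinv_n1 ?subr0 //; lia.
Qed.

(** The left sides at 1 and n - 1 are opposite to each other, so that r + (n - j) = 2 t. The third
    one is then min(t, r) + min(t, n - j) - 2 t, which is negative unless r = n - j = t. *)
Lemma unit_support r t : (0 < r < n)%N -> (0 < j < n)%N -> (0 < t < n)%N ->
  0 <= cinv 1 r + cinv 1 (n - j) - 2%:R * cinv 1 t ->
  0 <= cinv n.-1 r + cinv n.-1 (n - j) - 2%:R * cinv n.-1 t ->
  0 <= cinv t r + cinv t (n - j) - 2%:R * cinv t t ->
  t = r /\ r = (n - j)%N.
Proof.
move=> Hr Hj Ht.
have f1 : (r == n) = false by lia.
have f2 : (n - j == n)%N = false by lia.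
have f3 : (t == n)%N = false by lia.
have f4 : (0 < n - j)%N = true by lia.
have f5 : (0 < r)%N = true by lia.
have f6 : (0 < t)%N = true by lia.
rewrite !cinv_1 !cinv_pred ?leq_subr; try lia.
rewrite f1 f2 f3 f4 f5 f6 /= !subr0 => x1 xn.
have eq2 : r%:R / n%:R + (n - j)%:R / n%:R - 2%:R * (t%:R / n%:R) = 0 :> rat.
  by move: x1 xn; move: (r%:R / _) ((n - j)%:R / _) (t%:R / _) => u v w; lra.
have E2 : r%:R + (n - j)%:R = 2%:R * t%:R :> rat.
  apply: (mulIf (invr_neq0 n_neq0)).
  by apply/eqP; rewrite -subr_eq0 -eq2; apply/eqP; ring.
have -> : cinv t r + cinv t (n - j) - 2%:R * cinv t t =
    (minn t r)%:R + (minn t (n - j))%:R - 2%:R * t%:R.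
  rewrite /cinv minnn; transitivity ((minn t r)%:R + (minn t (n - j))%:R - 2%:R * t%:R
     - t%:R * (r%:R + (n - j)%:R - 2%:R * t%:R) / n%:R :> rat); first by ring.
  by rewrite E2 subrr; ring.
rewrite subr_ge0 -natrD -natrM ler_nat => H1.
move: E2; rewrite -natrD -natrM => /eqP; rewrite eqr_nat => /eqP E2.
by move: H1 E2 Hj; clear; lia.
Qed.

(** For 0 < b < n the entries of C^{-1} at (1, b) and (n - 1, b) add up to 1. Thus x_1 + x_{n-1} >=
    0 bounds the sum of the m_b by 1, leaving 0 and the unit vectors. *)
Lemma fermi_term0_support r m x : (0 < r <= n)%N -> (j < n)%N -> fermi_term 0 r m x != 0 ->
  m = 0 \/ (m = unitv r /\ (0 < r < n)%N /\ r = (n - j)%N).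
Proof.
move=> Hr Hj nz; have [->|mnz] := eqVneq m 0; [by left|right].
have pos := shifted_term_neq0 nz.
have mi0 (i : 'I_n.-1) : 0 <= m i.
  have [[k E] _] := pos i.+1 ltac:(have := ltn_ord i; lia).
  by move: E; rewrite addr0 mcoordS => E; rewrite -(ler_int rat) E.
have [i mi] : exists i, m i != 0.
  apply/existsP; rewrite -negb_forall; apply: contra mnz => /forallP H.
  by apply/eqP/ffunP => i; rewrite ffunE; apply/eqP.
have [_] := pos 1%N ltac:(lia); have [_] := pos n.-1 ltac:(lia).
rewrite !addr0 ?subr0 !nvec_lt ?mul0r ?add0r; try lia.
rewrite !(Cv_ev (leq_subr j n)); try lia.
set S1 := Cv n (mcoord m) 1; set Sn := Cv n (mcoord m) n.-1 => xn x1.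
have S : S1 + Sn = \sum_(b < n.-1) (m b)%:~R.
  rewrite /S1 /Sn !CvE -?big_split /=; try lia.
  apply: eq_bigr => b _; have bn := ltn_ord b.
  rewrite mcoordS cinv_1 ?cinv_pred; try lia.
  by rewrite (_ : (b.+1 == n) = false) /=; [ring | lia].
have Sle : \sum_(b < n.-1) (m b)%:~R <= ((r < n)%N : nat)%:R / 2 + (0 < j)%:R / 2 :> rat.
  rewrite -S; move: x1 xn; rewrite !cinv_1 ?cinv_pred ?leq_subr //; try lia.
  rewrite (_ : (n - j == n)%N = (j == 0)%N); last by lia.
  rewrite (_ : (0 < n - j)%N = true); last by lia.
  rewrite (_ : (r == n) = ~~ (r < n)%N); last by lia.
  rewrite (_ : (j == 0)%N = ~~ (0 < j)%N); last by lia.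
  rewrite (_ : (0 < r)%N = true); last by lia.
  by case: (r < n)%N; case: (0 < j)%N; rewrite /=; lra.
have mi1 : 1 <= (m i)%:~R :> rat.
  by rewrite (ler_int _ 1); have := mi0 i; move: mi; lia.
rewrite (bigD1 i) //= in Sle.
have rest0 : 0 <= \sum_(b < n.-1 | b != i) (m b)%:~R :> rat.
  by apply: sumr_ge0 => b _; rewrite ler0z.
have rn : (r < n)%N by move: Sle; case: (r < n)%N => //; case: (0 < j)%N; rewrite /=; lra.
have j0 : (0 < j)%N by move: Sle; rewrite rn; case: (0 < j)%N => //; rewrite /=; lra.
rewrite rn j0 /= in Sle.
have mE : m = unitv i.+1.
  apply/ffunP => b; rewrite ffunE eqSS; have [->|ne] := eqVneq b i.
    rewrite eqxx; have : (m i)%:~R <= (1 : int)%:~R :> rat by move: Sle rest0; lra.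
    by rewrite ler_int /=; move: mi1; rewrite (ler_int _ 1); lia.
  rewrite val_eqE (negbTE ne); have := mi0 b.
  have : (m b)%:~R < (1 : int)%:~R :> rat.
    rewrite (bigD1 b) //= in rest0 Sle.
    have : 0 <= \sum_(c < n.-1 | (c != i) && (c != b)) (m c)%:~R :> rat.
      by apply: sumr_ge0 => c _; rewrite ler0z.
    by move: Sle mi1; move: (m b)%:~R (m i)%:~R (\sum_(_ < _ | _) _) => u v w; lra.
  by rewrite ltr_int /=; lia.
have ltin : (0 < i.+1 < n)%N by have := ltn_ord i; lia.
have [_] := pos _ ltin.
move: x1 xn; rewrite /S1 /Sn mE.
have tn : (i.+1 <= n)%N by case/andP: ltin => _ /ltnW.
have jn := leq_subr j n.
rewrite (Cv_mcoord_unit tn (ltnW hn)) (Cv_mcoord_unit tn (leq_pred n)) addr0 ?subr0.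
rewrite nvec_lt; try by case/andP: Hr; case/andP: ltin.
rewrite mul0r add0r (Cv_ev jn tn) (Cv_mcoord_unit tn tn) => x1 xn xi.
have r0 : (0 < r)%N by case/andP: Hr.
have [] := @unit_support r i.+1 _ _ _ x1 xn xi; rewrite ?r0 ?j0 //.
by move=> E1 E2; rewrite E1 rn.
Qed.

(** The vectors 0 and e_r account for the conditions n | k and n | k + r. Both conditions hold
    together only for r = n, where e_r is itself 0. *)
Lemma fermi_init k r x : (0 < r <= n)%N -> (j < n)%N ->
  (2 * k + r = j %[mod n])%N ->
  fermi k 0 r x = ((n %| k) || (n %| k + r))%N%:R * qcoef (0, 1) x.
Proof.
move=> Hr Hj Hmod.
have dvd_int (a : nat) : (a%:R / n%:R \is a @Num.int rat) = (n %| a)%N.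
  apply/idP/idP => [/intrP [z Ez]|/dvdnP [q ->]]; last first.
    by rewrite natrM mulfK ?n_neq0 // natr_int.
  have : a%:R = z%:~R * n%:R :> rat by rewrite -Ez divfK ?n_neq0.
  move=> /eqP; rewrite -[n%:R]/((n%:Z)%:~R) -[a%:R]/((a%:Z)%:~R) -intrM eqr_int => /eqP E.
  by have : (n%:Z %| a%:Z)%Z by rewrite E dvdz_mull.
have dom0 : dom k 0 = (n %| k)%N.
  rewrite /dom -dvd_int (_ : Cv n (mcoord 0) n.-1 = 0) ?addr0 //.
  by rewrite -(subrr 0) Cv_mcoordD Cv_mcoordN subrr.
have domr : (r < n)%N -> dom k (unitv r) = (n %| k + r)%N.
  move=> rn; rewrite -dvd_int /dom natrD mulrDl.
  by rewrite (Cv_mcoord_unit (ltnW rn) (leq_pred n)) cinvC cinv_n1.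
have mz0 a : mcoord 0 a = 0 by rewrite -(subrr 0) mcoordD mcoordN subrr.
have Cv00 a : Cv n (mcoord 0) a = 0 by rewrite -(subrr 0) Cv_mcoordD Cv_mcoordN subrr.
have QQ0 : quad_exp 0 = 0.
  by rewrite /quad_exp /cinv_form !big1 ?subrr // => a _; rewrite mz0 mul0r.
case: (boolP (n %| k)%N) => nk.
  rewrite mul1r /fermi /dom_sum (@fsum_set1 _ _ 0) => [|m mnz].
    rewrite dom0 nk mul1r /fermi_term /shifted_term QQ0 add0r; congr (qcoef (_, _) x).
    rewrite /prodQ big1 // => i _; have ilt := ltn_ord i.
    have rj : r = j \/ (r = n /\ j = 0%N).
      have [q kq] := dvdnP nk; move: Hmod; rewrite kq mulnA modnMDl (modn_small Hj).
      have [->|ne] := eqVneq r n; first by rewrite modnn; right.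
      by rewrite modn_small; [left | lia].
    have i1 : (i.+1 < n)%N by lia.
    have /andP [_ rn] := Hr.
    rewrite /Nvec mz0 !addr0 add0r (nvec_lt _ _ rn i1) Cv00 (Cv_ev (leq_subr j n) (ltnW i1)).
    rewrite mul0r add0r mulr0 subr0; case: rj => [->|[-> ->]].
      (* The linear parts add up to -i since j + (n - j) = n; what remains is a natural number, so
         the q-binomial coefficient with lower entry 0 is 1. *)
      have -> : cinv i.+1 j + cinv i.+1 (n - j) = (minn i.+1 j + minn i.+1 (n - j) - i.+1)%N%:R.
        have le : (i.+1 <= minn i.+1 j + minn i.+1 (n - j))%N.
          by move: i1 Hj; clear; lia.
        have nz := n_neq0; rewrite /cinv (natrB _ le) natrD (natrB _ (ltnW Hj)).
        by field.
      exact: qbin_n0.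
    by rewrite subn0 !cinvn ?addr0 ?(qbin_n0 0) //; lia.
  have [->|nz] := eqVneq (fermi_term 0 r m x) 0; first by rewrite mulr0.
  have [E|[-> [rn E]]] := fermi_term0_support Hr Hj nz; first by rewrite E eqxx in mnz.
  rewrite domr; last by lia.
  rewrite dvdn_addr // (_ : (n %| r)%N = false) ?mul0r //.
  by apply/negbTE/negP => /dvdn_leq; lia.
case: (boolP (n %| k + r)%N) => nkr.
  have rn : (r < n)%N.
    rewrite ltn_neqAle; apply/andP; split; last by lia.
    by apply: contraNneq nk => E; move: nkr; rewrite E dvdn_addl.
  have rj : r = (n - j)%N.
    have kj : (k %% n = j)%N.
      by move: Hmod; rewrite mul2n -addnn -addnA -modnDmr (eqP nkr) addn0 (modn_small Hj).
    move: nkr; rewrite /dvdn -modnDml kj => /dvdnP [q Eq].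
    case: q Eq => [|[|q]] Eq; [lia|lia|].
    by move: Eq Hj Hr; rewrite !mulSn; clear; lia.
  rewrite mul1r /fermi /dom_sum (@fsum_set1 _ _ (unitv r)) => [|m mnz].
    rewrite domr // nkr mul1r /fermi_term /shifted_term addr0.
    have Hr' : (0 < r < n)%N by lia.
    have -> : quad_exp (unitv r) = 0.
      by rewrite /quad_exp !cinv_form_unit' ?Cv_mcoord_unit ?Cv_ev -?rj ?subrr //; lia.
    congr (qcoef (_, _) x); rewrite /prodQ big1 // => i _; have ilt := ltn_ord i.
    have i1 : (i.+1 < n)%N by lia.
    rewrite /Nvec !addr0 (nvec_lt _ _ (ltnW rn) i1) (Cv_mcoord_unit (ltnW rn) (ltnW i1)).
    rewrite (Cv_ev (leq_subr j n) (ltnW i1)) -rj.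
    rewrite mul0r add0r (_ : cinv i.+1 r + _ - _ = 0) ?addr0; last by ring.
    by rewrite mcoord_unit; exact: qbin_nn.
  have [->|nz] := eqVneq (fermi_term 0 r m x) 0; first by rewrite mulr0.
  have [->|[E _]] := fermi_term0_support Hr Hj nz; last by rewrite E eqxx in mnz.
  by rewrite dom0 (negbTE nk) mul0r.
rewrite mul0r /fermi /dom_sum fsum0 // => m.
have [->|nz] := eqVneq (fermi_term 0 r m x) 0; first by rewrite mulr0.
have [->|[-> [rn E]]] := fermi_term0_support Hr Hj nz; first by rewrite dom0 (negbTE nk) mul0r.
by rewrite domr ?(negbTE nkr) ?mul0r //; lia.
Qed.

End Fermion.

(** * From the integer lattice to the summation vectors of the theorem *)

Section Link.
Variables (n : nat) (hn : (2 <= n)%N) (j : nat).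
Local Notation V := {ffun 'I_n.-1 -> int}.

Definition emb (m : {ffun 'I_n.-1 -> nat}) : V := [ffun i => (m i)%:Z].

Lemma emb_inj : injective emb.
Proof.
move=> m1 m2 E; apply/ffunP => i; have := congr1 (fun f : V => f i) E.
by rewrite !ffunE => -[].
Qed.

Lemma mvec_emb m a : mvec m a = mcoord (emb m) a.
Proof. by apply: eq_bigr => i _; rewrite ffunE. Qed.

Lemma Cv_mvec m a : Cv n (mvec m) a = Cv n (mcoord (emb m)) a.
Proof. by apply: eq_bigr => b _; rewrite mvec_emb. Qed.

Lemma lhs_termE L r m x :
  qcoef (lhs_term L j r m) x = fermi_term j L r (emb m) x.
Proof.
apply: qcoef_eq; last first.
  congr (_ - _); rewrite addr0 /quad_exp /cinv_form; congr (_ - _); apply: eq_bigr => i _.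
    by rewrite Cv_mvec mcoordS ffunE.
  by rewrite mcoordS ffunE.
apply: eq_bigr => i _; have ilt := ltn_ord i.
rewrite !addr0 /Nvec mcoordS ffunE.
rewrite [in RHS]/qbin -[(m i)%:~R]/((m i)%:R) natr_nat truncn_natr.
congr (qbinom (_ + _) _); rewrite /nvec (_ : (i.+1 == n) = false) /=; last by lia.
rewrite mulr0n addr0 -Cv_mvec -!CvZ -!CvD -mulN1r -CvZ -CvD.
by apply: eq_bigr => b _; congr (_ * _); ring.
Qed.

Lemma lhs_domE k m : lhs_dom k m = dom k (emb m) :> Prop.
Proof. by rewrite /lhs_dom /dom /= Cv_mvec. Qed.

Lemma lhs_finite L k r x :
  finite_set [set m | @lhs_dom n k m /\ qcoef (lhs_term L j r m) x != 0].
Proof.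
have ff : fsupp (fun m : V => fermi_term j L r m x).
  by apply: (fsupp_shifted_term hn) => a _; split; [exact: ler0n 2 | rewrite subr0 oppr_le0; exact: ler0n].
have := @finite_preimage _ _ [set m | fermi_term j L r m x != 0] emb.
move=> /(_ (fun x y _ _ => @emb_inj x y) ff).
by apply: sub_finite_set => m [_]; rewrite lhs_termE.
Qed.

Lemma lhs_sum L k r x :
  \sum_(m \in @lhs_dom n k) qcoef (lhs_term L j r m) x = fermi n j k L r x.
Proof.
rewrite fsbig_mkcond /fermi /dom_sum /fsum.
(* A negative m_i makes its q-binomial coefficient vanish, so only the image of [emb]
   contributes. *)
rewrite -(fsbig_widen (range emb)) //; last first.
  move=> m [_ nr] /=; apply/eqP; apply: contrapT => /negP.
  rewrite mulf_eq0 negb_or => /andP [_ nz]; apply: nr.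
  exists [ffun i => absz (m i)] => //; apply/ffunP => i; rewrite !ffunE.
  have iin : (0 < i.+1 < n)%N by have := ltn_ord i; lia.
  have [[k0 E] _] := shifted_term_neq0 hn nz iin.
  by move: E; rewrite addr0 mcoordS => E; rewrite gez0_abs // -(ler_int rat) E.
rewrite fsbig_image; last by move=> m1 m2 _ _; exact: emb_inj.
apply: eq_fsbigr => m _; rewrite /functions.patch lhs_termE.
case: ifPn; rewrite ?inE ?notin_setE lhs_domE.
  by move=> ->; rewrite mul1r.
by move/negP/negbTE => ->; rewrite mul0r.
Qed.

End Link.

(** * The affine Weyl group *)

Section Weights.
Variables (n : nat) (hn : (2 <= n)%N).
Let npos : (0 < n)%N. Proof. lia. Qed.

Definition wcoef (l : wt n) (a : nat) : rat := l 0 (inord (a %% n)).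
Definition dcoef (l : wt n) : rat := l 0 ord_max.
Definition level (l : wt n) : rat := \sum_(a < n) wcoef l a.

Lemma wcoefD u v a : wcoef (u + v) a = wcoef u a + wcoef v a. Proof. by rewrite /wcoef mxE. Qed.
Lemma wcoefN u a : wcoef (- u) a = - wcoef u a. Proof. by rewrite /wcoef mxE. Qed.
Lemma wcoefZ c u a : wcoef (c *: u) a = c * wcoef u a. Proof. by rewrite /wcoef mxE. Qed.
Lemma dcoefD u v : dcoef (u + v) = dcoef u + dcoef v. Proof. by rewrite /dcoef mxE. Qed.
Lemma dcoefZ c u : dcoef (c *: u) = c * dcoef u. Proof. by rewrite /dcoef mxE. Qed.

Lemma levelD u v : level (u + v) = level u + level v.
Proof. by rewrite /level -big_split; apply: eq_bigr => a _; rewrite wcoefD. Qed.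
Lemma levelN u : level (- u) = - level u.
Proof. by rewrite /level -sumrN; apply: eq_bigr => a _; rewrite wcoefN. Qed.
Lemma levelZ c u : level (c *: u) = c * level u.
Proof. by rewrite /level mulr_sumr; apply: eq_bigr => a _; rewrite wcoefZ. Qed.

Lemma wcoef_Lam t a : wcoef (Lam n t) a = (a == t %[mod n])%:R.
Proof.
by rewrite /wcoef mxE inordK ?modn_mod // ltnS ltnW // ltn_mod.
Qed.

Lemma dcoef_Lam t : dcoef (Lam n t) = 0.
Proof.
rewrite /dcoef mxE /= (_ : (n == t %% n)%N = false) //.
by apply/negbTE; rewrite neq_ltn orbC ltn_mod npos.
Qed.

Lemma wcoef_delta a : wcoef (deltaW n) a = 0.
Proof.
rewrite /wcoef mxE inordK; last by rewrite ltnS ltnW // ltn_mod.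
by rewrite (_ : (a %% n == n)%N = false) //; apply/negbTE; rewrite neq_ltn ltn_mod npos.
Qed.

Lemma dcoef_delta : dcoef (deltaW n) = 1.
Proof. by rewrite /dcoef mxE /= eqxx. Qed.

Lemma level_Lam t : level (Lam n t) = 1.
Proof.
rewrite /level (bigD1 (Ordinal (_ : (t %% n < n)%N))) //=; first by rewrite ltn_mod.
move=> H; rewrite wcoef_Lam modn_mod eqxx big1 ?addr0 // => a.
rewrite -val_eqE /= => ne; rewrite wcoef_Lam modn_small //.
by rewrite (negbTE ne).
Qed.

Lemma level_delta : level (deltaW n) = 0.
Proof. by rewrite /level big1 // => a _; rewrite wcoef_delta. Qed.

Lemma wt_ext u v : (forall a, (a < n)%N -> wcoef u a = wcoef v a) -> dcoef u = dcoef v -> u = v.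
Proof.
move=> Hc Hd; apply/rowP => i; have [lt|ge] := ltnP i n.
  have := Hc _ lt; rewrite /wcoef modn_small //.
  by have -> : inord i = i by apply: val_inj; rewrite /= inordK.
have -> : i = ord_max by apply: val_inj => /=; have := ltn_ord i; lia.
exact: Hd.
Qed.

Lemma formE (u v : wt n) : form u v =
  \sum_(a < n) \sum_(b < n) wcoef u a * wcoef v b * cinv n a b + level u * dcoef v + dcoef u * level v.
Proof.
rewrite /form big_ord_recr /=.
have wE (w : wt n) (a : 'I_n) : w 0 (widen_ord (leqnSn n) a) = wcoef w a.
  rewrite /wcoef modn_small //; congr (w 0 _); apply: val_inj => /=.
  by rewrite inordK // ltnS ltnW.
rewrite (eq_bigr (fun a : 'I_n => \sum_(b < n) wcoef u a * wcoef v b * cinv n a b + wcoef u a * dcoef v)).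
  rewrite big_split /= -mulr_suml; congr (_ + _ + _).
  rewrite big_ord_recr /= !ltnn eqxx /= mulr0 addr0 /level mulr_sumr.
  by apply: eq_bigr => b _; rewrite wE ltn_ord mulr1.
move=> a _; rewrite big_ord_recr /= !ltn_ord /= ltnn eqxx /= mulr1 wE; congr (_ + _).
by apply: eq_bigr => b _; rewrite wE ltn_ord /= /cinv natrM.
Qed.

Lemma formC (u v : wt n) : form u v = form v u.
Proof.
rewrite !formE exchange_big /= -!addrA; congr (_ + _); last by rewrite addrC [_ * dcoef v]mulrC [dcoef u * _]mulrC.
by apply: eq_bigr => b _; apply: eq_bigr => a _; rewrite cinvC; ring.
Qed.

Lemma formDl (u v w : wt n) : form (u + v) w = form u w + form v w.
Proof.
rewrite !formE levelD dcoefD; under eq_bigr do under eq_bigr do rewrite wcoefD !mulrDl.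
under eq_bigr do rewrite big_split.
by rewrite big_split /=; ring.
Qed.

Lemma formZl c (u w : wt n) : form (c *: u) w = c * form u w.
Proof.
rewrite !formE levelZ dcoefZ.
have -> : \sum_(a < n) \sum_(b < n) wcoef (c *: u) a * wcoef w b * cinv n a b =
    c * \sum_(a < n) \sum_(b < n) wcoef u a * wcoef w b * cinv n a b.
  rewrite [RHS]mulr_sumr; apply: eq_bigr => a _; rewrite [RHS]mulr_sumr.
  by apply: eq_bigr => b _; rewrite wcoefZ; ring.
by ring.
Qed.

Lemma formNl (u w : wt n) : form (- u) w = - form u w.
Proof. by rewrite -scaleN1r formZl mulN1r. Qed.
Lemma formDr (u v w : wt n) : form w (u + v) = form w u + form w v.
Proof. by rewrite formC formDl ![form _ w]formC. Qed.
Lemma formZr c (u w : wt n) : form w (c *: u) = c * form w u.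
Proof. by rewrite formC formZl formC. Qed.
Lemma formNr (u w : wt n) : form w (- u) = - form w u.
Proof. by rewrite formC formNl formC. Qed.

Lemma form_delta (l : wt n) : form l (deltaW n) = level l.
Proof.
rewrite formE dcoef_delta level_delta mulr0 mulr1 addr0 big1 ?add0r // => a _.
by rewrite big1 // => b _; rewrite wcoef_delta mulr0 mul0r.
Qed.

Lemma form_Lam (l : wt n) t : (t <= n)%N ->
  form l (Lam n t) = \sum_(a < n) wcoef l a * cinv n a t + dcoef l.
Proof.
move=> tn; rewrite formE dcoef_Lam level_Lam mulr0 mulr1 addr0; congr (_ + _).
apply: eq_bigr => a _; have tm : (t %% n < n)%N by rewrite ltn_mod.
rewrite (bigD1 (Ordinal tm)) //= big1 ?addr0 => [|b].
  rewrite wcoef_Lam modn_mod eqxx mulr1; congr (_ * _).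
  (* Lambda_n is Lambda_0, and [cinv] vanishes at both indices. *)
  have [->|ne] := eqVneq t n; last by rewrite modn_small //; lia.
  by rewrite modnn cinv0 cinvn // ltnW.
rewrite -val_eqE /= => ne; rewrite wcoef_Lam modn_small //.
by rewrite (negbTE ne) mulr0 mul0r.
Qed.

Definition prv (i : nat) : nat := ((i + n - 1) %% n)%N.

Lemma Lam_mod t : Lam n (t %% n) = Lam n t.
Proof. by rewrite /Lam modn_mod. Qed.

Lemma Lam_eq t t' : t = t' %[mod n] -> Lam n t = Lam n t'.
Proof. by move=> E; rewrite -Lam_mod E Lam_mod. Qed.

(** For i > 0 the second difference of [cinv] at i is a delta function. For i = 0, delta contributes
    the level, and 1 - [cinv] n a (n - 1) - [cinv] n a 1 is 1 at a = 0 and 0 at the other a < n. *)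
Lemma form_alpha (l : wt n) i : (i < n)%N -> form l (alpha n i) = wcoef l i.
Proof.
move=> lin; rewrite /alpha !formDr !formNr formZr formZr form_delta.
have -> : Lam n (i + n - 1) = Lam n (if i == 0%N then n.-1 else i.-1).
  apply: Lam_eq; case: eqP => [->|ne]; first by rewrite add0n subn1.
  by rewrite (_ : (i + n - 1)%N = (i.-1 + n)%N) ?modnDr //; lia.
rewrite !form_Lam ?(ltnW lin) //; last by case: eqP; lia.
case: eqP => [->|i0] /=; last first.
  rewrite mul0r addr0.
  transitivity (\sum_(a < n) wcoef l a * (2%:R * cinv n a i - cinv n a i.-1 - cinv n a i.+1)).
    transitivity (2%:R * (\sum_(a < n) wcoef l a * cinv n a i) - \sum_(a < n) wcoef l a * cinv n a i.-1
      - \sum_(a < n) wcoef l a * cinv n a i.+1); first by ring.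
    by rewrite mulr_sumr -!sumrB; apply: eq_bigr => a _; ring.
  rewrite (bigD1 (Ordinal lin)) //= big1 => [|a].
    have E1 := cinv_diff hn i i.-1; have E2 := cinv_diff hn i i.
    rewrite prednK ?leqnn ?ltnn /= in E1 E2; try lia.
    rewrite addr0 (_ : 2%:R * _ - _ - _ = 1) ?mulr1 //.
    by move: E1 E2; move: (cinv _ _ _) (cinv _ _ _) (cinv _ _ _) (_ / _) => *; lra.
  rewrite -val_eqE /= => ne.
  have E1 := cinv_diff hn a i.-1; have E2 := cinv_diff hn a i.
  rewrite prednK in E1; last by lia.
  rewrite (_ : (i < a) = (i <= a))%N in E2; last by lia.
  rewrite (_ : 2%:R * _ - _ - _ = 0) ?mulr0 //.
  by move: E1 E2; move: (cinv _ _ _) (cinv _ _ _) (cinv _ _ _) (_ / _) (_%:R) => *; lra.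
transitivity (\sum_(a < n) wcoef l a * (1 - cinv n a n.-1 - cinv n a 1)).
  rewrite [X in X + dcoef l]big1 => [|a _]; last by rewrite cinv0 mulr0.
  transitivity (level l - \sum_(a < n) wcoef l a * cinv n a n.-1 - \sum_(a < n) wcoef l a * cinv n a 1).
    by ring.
  by rewrite /level -!sumrB; apply: eq_bigr => a _; ring.
rewrite (bigD1 (Ordinal npos)) //= big1 => [|a].
  have c0 b : cinv n 0 b = 0 by rewrite cinvC cinv0.
  by rewrite !c0; ring.
rewrite -val_eqE /= => ne; have an := ltn_ord a.
have a0 : (0 < a)%N by lia.
have -> : cinv n a n.-1 = a%:R / n%:R by exact: cinv_n1.
have -> : cinv n a 1 = (0 < a)%:R - a%:R / n%:R by rewrite cinvC; exact: cinv_1.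
by rewrite a0 /=; ring.
Qed.

End Weights.

(** * Simple reflections in the coordinates dual to the weights hat s *)

Section Reflections.
Variables (n : nat) (hn : (2 <= n)%N).
Let npos : (0 < n)%N. Proof. lia. Qed.

Lemma prv_lt i : (prv n i < n)%N. Proof. by rewrite ltn_mod. Qed.

Lemma Lam_prv i : (i < n)%N -> Lam n (prv n i).+1 = Lam n i.
Proof.
move=> lin; apply: Lam_eq; rewrite /prv -addn1 modnDml.
by rewrite (_ : (i + n - 1 + 1)%N = (i + n)%N) ?modnDr //; lia.
Qed.

Lemma alphaE i : (i < n)%N ->
  alpha n i = hatW n (prv n i) - hatW n i + (i == 0)%N%:R *: deltaW n.
Proof.
move=> lin; rewrite /alpha /hatW Lam_prv // /prv Lam_mod; congr (_ + _).
move: (Lam n i) (Lam n _) (Lam n _) => u v w.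
by apply/rowP => b; rewrite !mxE; ring.
Qed.

(** These play the part of the epsilon-coordinates of gl(n): the affine Weyl group permutes them and
    translates them by integral multiples of the level. *)
Definition hat_coord (s : nat) (l : wt n) : rat := form l (hatW n s).

Lemma hat_coordD s u v : hat_coord s (u + v) = hat_coord s u + hat_coord s v. Proof. exact: formDl. Qed.
Lemma hat_coordN s u : hat_coord s (- u) = - hat_coord s u. Proof. exact: formNl. Qed.
Lemma hat_coordZ s c u : hat_coord s (c *: u) = c * hat_coord s u. Proof. exact: formZl. Qed.

Lemma level_hat s : level (hatW n s) = 0.
Proof. by rewrite levelD levelN !level_Lam // subrr. Qed.

Lemma hat_coord_delta s : hat_coord s (deltaW n) = 0.
Proof. by rewrite /hat_coord formC form_delta // level_hat. Qed.

Lemma wcoef_fs l i : (i < n)%N ->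
  wcoef l i = hat_coord (prv n i) l - hat_coord i l + (i == 0)%N%:R * level l.
Proof.
by move=> lin; rewrite -form_alpha // alphaE // 2!formDr // formNr // formZr // form_delta.
Qed.

Lemma form_LamLam t p : (t <= n)%N -> (p <= n)%N -> form (Lam n t) (Lam n p) = cinv n t p.
Proof.
move=> tn pn; rewrite form_Lam // dcoef_Lam // addr0.
have tm : (t %% n < n)%N by rewrite ltn_mod.
rewrite (bigD1 (Ordinal tm)) //= big1 ?addr0 => [|a].
  rewrite wcoef_Lam // modn_mod eqxx mul1r.
  have [->|ne] := eqVneq t n; last by rewrite modn_small //; lia.
  by rewrite modnn ![cinv n _ p]cinvC cinv0 cinvn.
rewrite -val_eqE /= => ne; rewrite wcoef_Lam // modn_small //.
by rewrite (negbTE ne) mul0r.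
Qed.

Lemma hat_coord_Lam s t : (s < n)%N -> (t <= n)%N -> hat_coord s (Lam n t) = (s < t)%:R - t%:R / n%:R.
Proof.
move=> sn tn; rewrite /hat_coord /hatW formDr // formNr // !form_LamLam ?(ltnW sn) //.
by rewrite cinv_diff.
Qed.

Lemma hat_coord_hat s t : (s < n)%N -> (t < n)%N -> hat_coord s (hatW n t) = (s == t)%:R - n%:R^-1.
Proof.
move=> sn tn; rewrite /hatW hat_coordD hat_coordN !hat_coord_Lam ?(ltnW tn) // -natr1 ltnS.
rewrite (_ : (s <= t)%:R = (s < t)%:R + (s == t)%:R); last by rewrite -natrD; congr (_%:R); lia.
by ring.
Qed.

Lemma level_alpha i : (i < n)%N -> level (alpha n i) = 0.
Proof.
by move=> lin; rewrite alphaE // 2!levelD levelN levelZ !level_hat level_delta //; ring.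
Qed.

Lemma hat_coord_alpha s i : (s < n)%N -> (i < n)%N ->
  hat_coord s (alpha n i) = (s == prv n i)%:R - (s == i)%:R.
Proof.
move=> sn lin; rewrite alphaE // 2!hat_coordD hat_coordN hat_coordZ hat_coord_delta !hat_coord_hat ?prv_lt //; ring.
Qed.

Lemma prv_neq i : (i < n)%N -> (i == prv n i) = false.
Proof.
move=> lin; apply/negbTE/eqP => E.
have : (i.+1 = i %[mod n])%N.
  rewrite [in LHS]E /prv -addn1 modnDml.
  by rewrite (_ : (i + n - 1 + 1)%N = (i + n)%N) ?modnDr //; lia.
rewrite (modn_small lin); case: (ltnP i.+1 n) => H; first by rewrite modn_small //; lia.
by rewrite (_ : i.+1 = n) ?modnn; lia.
Qed.

Lemma wcoef_alpha i : (i < n)%N -> wcoef (alpha n i) i = 2%:R.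
Proof.
move=> lin; rewrite wcoef_fs // !hat_coord_alpha ?prv_lt // level_alpha //.
by rewrite !eqxx [_ == i]eq_sym prv_neq //=; ring.
Qed.

Lemma srefE l i : (i < n)%N -> sref i l = l - wcoef l i *: alpha n i.
Proof. by move=> lin; rewrite /sref form_alpha. Qed.

Lemma form_sum (I : finType) (c : I -> rat) (u : I -> wt n) v :
  form (\sum_i c i *: u i) v = \sum_i c i * form (u i) v.
Proof.
rewrite (big_morph (fun w => form w v) (id1 := 0) (op1 := +%R)).
- by apply: eq_bigr => i _; rewrite formZl.
- by move=> u1 u2; rewrite formDl.
by rewrite -(scale0r (0 : wt n)) formZl // mul0r.
Qed.

Lemma mul_genmx (l : wt n) i : (i < n)%N -> l *m genmx n i = sref i l.
Proof.
move=> lin; apply/rowP => b; rewrite !mxE.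
under eq_bigr do rewrite !mxE mulrBr.
rewrite big_split /= sumrN; congr (_ - _).
  rewrite (bigD1 b) //= eqxx mulr1 big1 ?addr0 // => a ne.
  by rewrite eq_sym (negbTE ne) mulr0.
rewrite {2}(row_sum_delta l) form_sum mulr_suml.
by apply: eq_bigr => a _; rewrite mulrA.
Qed.

Lemma mul_genmxE (l : wt n) i : (i < n)%N -> l *m genmx n i = l - wcoef l i *: alpha n i.
Proof. by move=> lin; rewrite mul_genmx // srefE. Qed.

Lemma sref_invol (l : wt n) i : (i < n)%N -> l *m genmx n i *m genmx n i = l.
Proof.
move=> lin; rewrite !mul_genmxE // wcoefD wcoefN wcoefZ wcoef_alpha //.
by move: (wcoef l i) (alpha n i) => c u; apply/rowP => b; rewrite !mxE; ring.
Qed.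

Lemma form_sref (u v : wt n) i : (i < n)%N ->
  form (u *m genmx n i) (v *m genmx n i) = form u v.
Proof.
move=> lin; rewrite !mul_genmxE // !formDl // !formDr // !formNl // !formNr //.
rewrite !formZl // !formZr // [form (alpha n i) v]formC // !form_alpha // wcoef_alpha //.
by ring.
Qed.

Lemma mulmx_ext (A B : 'M[rat]_(n.+1)) : (forall l : wt n, l *m A = l *m B) -> A = B.
Proof. by move=> H; apply/row_matrixP => i; rewrite !rowE H. Qed.

Lemma genmx_invol i : (i < n)%N -> genmx n i *m genmx n i = 1%:M.
Proof. by move=> lin; apply: mulmx_ext => l; rewrite mulmxA sref_invol // mulmx1. Qed.

(** Two block triangular factorizations of one matrix. A simple reflection has this form with v u =
    2, so its determinant is -1 and [\det] is the sign on the Weyl group. *)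
Lemma det_1subM m (u : 'cV[rat]_m) (v : 'rV[rat]_m) :
  \det (1%:M - u *m v) = 1 - (v *m u) 0 0.
Proof.
have E : block_mx 1%:M u v 1%:M = block_mx 1%:M 0 v 1%:M *m block_mx 1%:M u 0 (1%:M - v *m u) :> 'M[rat]_(m + 1).
  by rewrite mulmx_block !mul1mx !mul0mx !mulmx1 !addr0 addrC subrK.
have E' : block_mx 1%:M u v 1%:M = block_mx (1%:M - u *m v) u 0 1%:M *m block_mx 1%:M 0 v 1%:M :> 'M[rat]_(m + 1).
  by rewrite mulmx_block !mul1mx !mul0mx !mulmx1 mulmx0 !add0r subrK.
have : \det (block_mx 1%:M u v 1%:M : 'M[rat]_(m + 1)) = \det (1%:M - v *m u).
  by rewrite E det_mulmx det_lblock det_ublock !det1 !mul1r.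
rewrite {1}E' det_mulmx det_lblock det_ublock !det1 !mulr1 => ->.
by rewrite det_mx11 !mxE.
Qed.

Lemma det_genmx i : (i < n)%N -> \det (genmx n i) = -1.
Proof.
move=> lin; have linS : (i < n.+1)%N by rewrite ltnS ltnW.
pose u : 'cV[rat]_(n.+1) := delta_mx (Ordinal linS) 0.
have wcoef_mul (l : wt n) : (l *m u) 0 0 = wcoef l i.
  rewrite mxE (bigD1 (Ordinal linS)) //= big1 ?addr0 => [|a ne].
    rewrite mxE !eqxx mulr1 /wcoef modn_small //; congr (l 0 _).
    by apply: val_inj; rewrite /= inordK.
  by rewrite mxE (negbTE ne) mulr0.
have -> : genmx n i = 1%:M - u *m alpha n i.
  apply: mulmx_ext => l; rewrite mul_genmxE // mulmxBr mulmx1 mulmxA; congr (_ - _).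
  by rewrite [l *m u]mx11_scalar mul_scalar_mx wcoef_mul.
by rewrite det_1subM wcoef_mul wcoef_alpha //; ring.
Qed.

End Reflections.

Lemma perm_mono_ge n (p : {perm 'I_n}) : (forall s t : 'I_n, (s < t)%N -> (p s < p t)%N) ->
  forall s : 'I_n, (s <= p s)%N.
Proof.
move=> mono [s sn] /=; elim: s sn => [|s IH] sn //.
have sn' : (s < n)%N by exact: ltnW.
by apply: leq_ltn_trans (IH sn') _; apply: mono.
Qed.

Lemma perm_mono n (p : {perm 'I_n}) : (forall s t : 'I_n, (s < t)%N -> (p s < p t)%N) ->
  forall s, p s = s.
Proof.
move=> mono s; apply/val_inj/eqP; rewrite eqn_leq perm_mono_ge // andbT.
have := @perm_mono_ge n p^-1%g _ (p s); rewrite permK; apply => {}s t st.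
case: (ltngtP (p^-1%g s) (p^-1%g t)) => // [/mono|/val_inj /perm_inj E].
  by rewrite !permKV => ts; move: st; rewrite ltnNge (ltnW ts).
by rewrite E ltnn in st.
Qed.

(** * Freeness of the Weyl group action on strictly dominant weights *)

Section WeylGroup.
Variables (n : nat) (hn : (2 <= n)%N).
Let npos : (0 < n)%N. Proof. lia. Qed.

Lemma hat_coord_genmx (l : wt n) s i : (s < n)%N -> (i < n)%N ->
  hat_coord s (l *m genmx n i) = hat_coord s l - wcoef l i * ((s == prv n i)%:R - (s == i)%:R).
Proof.
by move=> sn lin; rewrite mul_genmxE // hat_coordD // hat_coordN // hat_coordZ // hat_coord_alpha.
Qed.

Local Notation Wg := (@Weyl n).

Lemma Weyl_ind (P : 'M[rat]_(n.+1) -> Prop) :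
  P 1%:M -> (forall (i : 'I_n) M, Wg M -> P M -> P (genmx n i *m M)) ->
  forall M, Wg M -> P M.
Proof.
move=> P1 PS M [ws ->]; elim: ws => [|i ws IH]; first by rewrite big_nil.
by rewrite big_cons; apply: PS => //; exists ws.
Qed.

Lemma Weyl_id : Wg 1%:M.
Proof. by exists [::]; rewrite big_nil. Qed.

Lemma Weyl_genmx (i : 'I_n) M : Wg M -> Wg (M *m genmx n i).
Proof.
by move=> [ws ->]; exists (rcons ws i); rewrite -cats1 big_cat big_seq1.
Qed.

Lemma Weyl_mul M M' : Wg M -> Wg M' -> Wg (M *m M').
Proof. by move=> [ws ->] [ws' ->]; exists (ws ++ ws'); rewrite big_cat. Qed.

Lemma Weyl_inv M : Wg M -> exists2 M', Wg M' & M *m M' = 1%:M.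
Proof.
move: M; apply: Weyl_ind => [|i M _ [M' WM' E]].
  by exists 1%:M; [exact: Weyl_id | rewrite mulmx1].
exists (M' *m genmx n i); first exact: Weyl_genmx.
by rewrite -mulmxA (mulmxA M) E mul1mx genmx_invol.
Qed.

Lemma Weyl_delta M : Wg M -> deltaW n *m M = deltaW n.
Proof.
move: M; apply: Weyl_ind => [|i M _ E]; first by rewrite mulmx1.
by rewrite mulmxA mul_genmxE // wcoef_delta // scale0r subr0.
Qed.

Lemma Weyl_level M (l : wt n) : Wg M -> level (l *m M) = level l.
Proof.
move=> WM; move: M WM l; apply: Weyl_ind => [l|i M _ E l]; first by rewrite mulmx1.
by rewrite mulmxA E mul_genmxE // levelD levelN levelZ level_alpha // mulr0 subr0.
Qed.

Lemma Weyl_form M (u v : wt n) : Wg M -> form (u *m M) (v *m M) = form u v.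
Proof.
move=> WM; move: M WM u v; apply: Weyl_ind => [u v|i M _ E u v]; first by rewrite !mulmx1.
by rewrite !mulmxA E form_sref.
Qed.

(** This maps the group to affine permutations. Only s_0 translates, because its root contains
    delta, which pairs with a weight to the level. *)
Lemma Weyl_hat_coord M : Wg M -> exists (p : {perm 'I_n}) (v : 'I_n -> int),
  \sum_s v s = 0 /\ forall (l : wt n) (s : 'I_n),
  hat_coord s (l *m M) = hat_coord (p s) l + level l * (v s)%:~R.
Proof.
move: M; apply: Weyl_ind => [|i M _ [p [v [v0 E]]]].
  exists 1%g, (fun=> 0); split; first by rewrite big1.
  by move=> l s; rewrite mulmx1 perm1 mulr0 addr0.
pose pi := Ordinal (prv_lt hn i).
pose vi (s : 'I_n) : int := ((i == 0%N :> nat) : nat)%:Z * (((s == i) : nat)%:Z - ((s == pi) : nat)%:Z).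
exists (p * tperm pi i)%g, (fun s => vi (p s) + v s); split.
  have vis : \sum_s vi (p s) = \sum_s vi s by rewrite [RHS](reindex_inj (@perm_inj _ p)).
  rewrite big_split /= v0 addr0 vis /vi -mulr_sumr sumrB.
  have one (t : 'I_n) : \sum_s ((s == t) : nat)%:Z = 1.
    by rewrite (bigD1 t) //= eqxx big1 ?addr0 // => s /negbTE ->.
  by rewrite !one subrr mulr0.
move=> l s; rewrite mulmxA E Weyl_level; last first.
  by rewrite -[genmx n i]mul1mx; apply: Weyl_genmx; exact: Weyl_id.
rewrite hat_coord_genmx // permM intrD [level l * (_ + _)]mulrDr addrA; congr (_ + _).
rewrite (wcoef_fs hn) // /vi intrM intrB.
set t := p s.
have neq : (i == pi) = false by rewrite -val_eqE /= prv_neq.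
rewrite -[(t == prv n i :> nat)]/(t == pi) -[(t == i :> nat)]/(t == i).
case: tpermP => [->|->|/eqP /negbTE ne1 /eqP /negbTE ne2].
- by rewrite eqxx [pi == i]eq_sym neq /=; ring.
- by rewrite eqxx neq /=; ring.
by rewrite ne1 ne2 /=; ring.
Qed.

Definition sdom (l : wt n) := forall a, (a < n)%N -> 0 < wcoef l a.

Lemma sdom_hat_coord_lt l s t : sdom l -> (s < t)%N -> (t < n)%N -> hat_coord t l < hat_coord s l.
Proof.
move=> sl; elim: t => // t IH; rewrite ltnS leq_eqVlt => st tn.
have step : hat_coord t.+1 l < hat_coord t l.
  have := sl _ tn; rewrite (wcoef_fs hn) //= mul0r addr0 subr_gt0.
  rewrite /prv (_ : (t.+1 + n - 1)%N = (t + n)%N) ?modnDr ?modn_small //; last by lia.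
  exact: ltnW.
case/orP: st => [/eqP -> //|st].
by apply: lt_trans step _; apply: IH => //; exact: ltnW.
Qed.

(** Positivity of the coefficient at 0 bounds the first coordinate minus the last; together with
    [sdom_hat_coord_lt] this describes the open fundamental alcove. *)
Lemma sdom_hat_coord_width l s t : sdom l -> (s < n)%N -> (t < n)%N -> hat_coord s l - hat_coord t l < level l.
Proof.
move=> sl sn tn; have := sl _ npos; rewrite (wcoef_fs hn) //= mul1r.
rewrite /prv add0n modn_small; last by lia.
have H1 : hat_coord s l <= hat_coord 0 l.
  by case: s sn => // s sn; apply/ltW/sdom_hat_coord_lt.
have H2 : hat_coord (n - 1) l <= hat_coord t l.
  have [->|ne] := eqVneq t (n - 1)%N; first by [].
  by apply/ltW/sdom_hat_coord_lt => //; lia.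
by move: H1 H2; move: (hat_coord _ _) (hat_coord _ _) (hat_coord _ _) (hat_coord _ _) (level _) => *; lra.
Qed.

(** If v took a positive and a negative value, two coordinates of l would differ by more than 2 - 1
    times the level, against [sdom_hat_coord_width]. So v has one sign and, having sum 0, vanishes;
    then p preserves the strict order of the coordinates. *)
Lemma sdom_unique (l m : wt n) (p : {perm 'I_n}) (v : 'I_n -> int) :
  sdom l -> sdom m -> level l = level m -> \sum_s v s = 0 ->
  (forall s : 'I_n, hat_coord s l = hat_coord (p s) m + level m * (v s)%:~R) ->
  (forall s, p s = s) /\ (forall s, v s = 0).
Proof.
move=> sl sm lm v0 E.
have vlt (s t : 'I_n) : ~ (1 <= v s /\ v t <= -1).
  move=> [vs vt].
  have lpos : 0 < level m.
    by have := sdom_hat_coord_width sm npos npos; rewrite subrr.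
  have := sdom_hat_coord_width sl (ltn_ord s) (ltn_ord t); rewrite !E lm.
  have := sdom_hat_coord_width sm (ltn_ord (p t)) (ltn_ord (p s)).
  have : level m * 2 <= level m * ((v s)%:~R - (v t)%:~R).
    rewrite ler_pM2l // -intrB (ler_int _ 2); lia.
  move: (hat_coord _ _) (hat_coord _ _) (v s)%:~R (v t)%:~R lpos => a b c d.
  by rewrite !mulrBr; lra.
have vz s : v s = 0.
  have key : (forall t, 0 <= v t) \/ (forall t, v t <= 0).
    have [/existsP [s0 Hs0]|/existsPn H] := boolP [exists s0, 0 < v s0].
      by left => t; rewrite leNgt; apply/negP => vt; apply: (vlt s0 t); lia.
    by right => t; have := H t; rewrite -leNgt.
  case: key => key.
    apply/eqP; have := v0; move/eqP; rewrite psumr_eq0 // => /allP /(_ s) /=.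
    by apply; rewrite mem_index_enum.
  apply/eqP; rewrite -oppr_eq0; have := congr1 -%R v0; rewrite oppr0 -sumrN.
  move/eqP; rewrite psumr_eq0 => [/allP /(_ s) /=|t _].
    by apply; rewrite mem_index_enum.
  by rewrite oppr_ge0.
split=> //; apply: perm_mono => s t st.
have := sdom_hat_coord_lt sl st (ltn_ord t); rewrite !E !vz !mulr0 !addr0.
case: (ltngtP (p s) (p t)) => // [ts|->]; last by rewrite ltxx.
by have := sdom_hat_coord_lt sm ts (ltn_ord (p s)); move/lt_trans => H /H; rewrite ltxx.
Qed.

Lemma hat_coord_eq_delta (l : wt n) : (forall s : 'I_n, hat_coord s l = 0) -> level l = 0 ->
  l = dcoef l *: deltaW n.
Proof.
move=> Hf Hl; apply: wt_ext => // [a an|]; last by rewrite dcoefZ dcoef_delta // mulr1.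
rewrite wcoefZ wcoef_delta // mulr0 (wcoef_fs hn) // Hl mulr0 addr0.
by rewrite (Hf (Ordinal an)) (Hf (Ordinal (prv_lt hn a))) subrr.
Qed.

(** These coordinates and the level fix a weight up to a multiple c of delta. Invariance of
    |Lambda_t|^2 gives 2 c = 0, because Lambda_t pairs with delta to 1. *)
Lemma Weyl_hat_coord_id M : Wg M ->
  (forall (l : wt n) (s : 'I_n), hat_coord s (l *m M) = hat_coord s l) -> M = 1%:M.
Proof.
move=> WM E.
have dif (l : wt n) : l *m M = l + dcoef (l *m M - l) *: deltaW n.
  have <- : l *m M - l = dcoef (l *m M - l) *: deltaW n.
    apply: hat_coord_eq_delta => [s|]; first by rewrite hat_coordD // hat_coordN // E subrr.
    by rewrite levelD levelN Weyl_level // subrr.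
  by rewrite addrC subrK.
have fixL t : Lam n t *m M = Lam n t.
  have := Weyl_form (Lam n t) (Lam n t) WM; rewrite [Lam n t *m M]dif.
  move: (dcoef _) => c; rewrite !formDl // !formDr // !formZl // !formZr //.
  rewrite [form (deltaW n) (Lam n t)]formC // !form_delta // level_Lam // level_delta // => H.
  have -> : c = 0 by move: H; move: (form _ _) => f; lra.
  by rewrite scale0r addr0.
apply/row_matrixP => a; rewrite !rowE mulmx1.
have [an|an] := ltnP a n.
  have -> : delta_mx 0 a = Lam n a :> wt n; last by [].
  apply/rowP => b; rewrite !mxE eqxx /= modn_small // -val_eqE /=.
have -> : delta_mx 0 a = deltaW n :> wt n; last exact: Weyl_delta.
apply/rowP => b; rewrite !mxE eqxx /= -val_eqE /=; congr (_ == _)%:R.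
by have := ltn_ord a; lia.
Qed.

Lemma Weyl_dominant M (l m : wt n) c : Wg M -> sdom l -> sdom m ->
  l - m *m M = c *: deltaW n -> M = 1%:M.
Proof.
move=> WM sl sm E; have [p [v [v0 Ev]]] := Weyl_hat_coord WM.
have lE : l = m *m M + c *: deltaW n by rewrite -E addrC subrK.
have lm : level l = level m by rewrite lE levelD levelZ level_delta // mulr0 addr0 Weyl_level.
have [] := @sdom_unique l m p v sl sm lm v0.
  by move=> s; rewrite lE hat_coordD // hat_coordZ // hat_coord_delta // mulr0 addr0 Ev.
move=> pid vz; apply: Weyl_hat_coord_id => // l' s.
by rewrite Ev pid vz mulr0 addr0.
Qed.

(** It is stated modulo delta because weights with the same composition differ by multiples of
    delta; it makes the Weyl group sums finite. *)
Lemma Weyl_regular M M' (m : wt n) c : Wg M -> Wg M' -> sdom m ->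
  m *m M - m *m M' = c *: deltaW n -> M = M'.
Proof.
move=> WM WM' sm E; have [N WN EN] := Weyl_inv WM'.
have E1 : M *m N = 1%:M.
  apply: (@Weyl_dominant _ m m (- c)) => //; first exact: Weyl_mul.
  have := congr1 (fun u => u *m N) E.
  rewrite mulmxBl -!mulmxA EN mulmx1 -scalemxAl Weyl_delta // => E2.
  by rewrite scaleNr -E2 opprB.
by rewrite -[M]mulmx1 -(mulmx1C EN) mulmxA E1 mul1mx.
Qed.

End WeylGroup.

(** * Bosonic side *)

Section Multinomial.
Variable n : nat.
Local Notation comp := {ffun 'I_n -> nat}.

Definition tsum (lam : comp) : nat := (\sum_s lam s)%N.
Definition psum (lam : comp) (a : nat) : nat := (\sum_(s < n | (s < a)%N) lam s)%N.
Definition pprod (lam : comp) : {poly rat} := \prod_s qpoch (lam s).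
Definition qmult (lam : comp) : {poly rat} := qpoch (tsum lam) %/ pprod lam.
Definition decr (lam : comp) (q : 'I_n) : comp := [ffun s => (lam s - (s == q))%N].

Lemma pprod_neq0 (lam : comp) : pprod lam != 0.
Proof. by apply/prodf_neq0 => s _; exact: qpoch_neq0. Qed.

Lemma psumS (lam : comp) (q : 'I_n) : psum lam q.+1 = (psum lam q + lam q)%N.
Proof.
rewrite /psum (bigD1 q) /= ?ltnS ?leqnn // addnC; congr (_ + _)%N.
by apply: eq_bigl => s; rewrite -val_eqE /=; lia.
Qed.

Lemma psum0 (lam : comp) : psum lam 0 = 0%N.
Proof. by rewrite /psum big1. Qed.

Lemma psumn (lam : comp) : psum lam n = tsum lam.
Proof. by apply: eq_bigl => s; rewrite ltn_ord. Qed.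

Lemma psum_le (lam : comp) a b : (a <= b)%N -> (psum lam a <= psum lam b)%N.
Proof.
move=> ab; rewrite /psum big_mkcond [leqRHS]big_mkcond; apply: leq_sum => s _.
by case: ltnP => // sa; rewrite (leq_trans sa ab).
Qed.

(* exponents of the q-multinomial recurrence which reads the letters in the cyclic
   order p - 1, ..., 0, n - 1, ..., p *)
Definition qexp lam p q : nat :=
  (psum lam p + (if (q < p)%N then 0 else tsum lam) - psum lam q.+1)%N.

Lemma qexp_lam (lam : comp) p (q : 'I_n) : (p <= n)%N ->
  (qexp lam p q + lam q = psum lam p + (if (q < p)%N then 0 else tsum lam) - psum lam q)%N.
Proof.
move=> pn; rewrite /qexp psumS; case: ltnP => qp.
  by have := @psum_le lam q.+1 p qp; rewrite psumS; lia.
by have := @psum_le lam q.+1 n (ltn_ord q); rewrite psumS psumn; lia.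
Qed.

(** Each summand is a difference of consecutive powers. The letters below [p] telescope to 1 -
    q^(psum p), the others to q^(psum p) - q^(tsum). *)
Lemma sum_qexp (lam : comp) p : (p <= n)%N ->
  \sum_(q < n) 'X^(qexp lam p q) * (1 - 'X^(lam q)) = 1 - 'X^(tsum lam) :> {poly rat}.
Proof.
move=> pn.
pose h0 a : {poly rat} := 'X^(psum lam p - psum lam a).
pose h1 a : {poly rat} := 'X^(psum lam p + tsum lam - psum lam a).
transitivity (\sum_(0 <= q < n) (if (q < p)%N then h0 q.+1 - h0 q else h1 q.+1 - h1 q)).
  rewrite big_mkord; apply: eq_bigr => q _.
  rewrite mulrBr mulr1 -exprD qexp_lam // /qexp /h0 /h1.
  by case: ifP; rewrite ?addn0.
rewrite (@big_cat_nat _ _ _ p) //=.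
rewrite (@eq_big_nat _ _ _ 0 p _ (fun q => h0 q.+1 - h0 q)) => [|q /andP [_ ->]] //.
rewrite (@eq_big_nat _ _ _ p n _ (fun q => h1 q.+1 - h1 q)) => [|q /andP [pq _]]; last first.
  by rewrite ltnNge pq.
rewrite !telescope_sumr // /h0 /h1 subnn psum0 subn0 psumn addnK addnC addnK.
by move: 'X^(psum _ _) 'X^(tsum _) => a b; ring.
Qed.

Lemma tsum_dec (lam : comp) q : (0 < lam q)%N -> (tsum (decr lam q)).+1 = tsum lam.
Proof.
move=> pos; rewrite /tsum (bigD1 q) //= [in RHS](bigD1 q) //= ffunE eqxx.
rewrite (eq_bigr (fun s => lam s)) => [|s /negbTE ne]; last by rewrite ffunE ne subn0.
by rewrite subn1 -addSn prednK.
Qed.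

Lemma pprod_dec (lam : comp) q : (0 < lam q)%N -> pprod lam = pprod (decr lam q) * (1 - 'X^(lam q)).
Proof.
move=> pos; rewrite /pprod (bigD1 q) //= [in RHS](bigD1 q) //= ffunE eqxx.
rewrite [in RHS](eq_bigr (fun s => qpoch (lam s))) => [|s /negbTE ne]; last by rewrite ffunE ne subn0.
have -> : qpoch (lam q) = qpoch (lam q - true) * (1 - 'X^(lam q)).
  by case: (lam q) pos => // m _; rewrite qpochS subn1.
by move: 'X^(lam q) => x; ring.
Qed.

(** Exactness of the division in [qmult]. The quotient is constructed along the recurrence with p =
    n, since [qmult_rec] itself rests on this exactness. *)
Lemma qmult_mul (lam : comp) : qmult lam * pprod lam = qpoch (tsum lam).
Proof.
suff [u E] : exists u, u * pprod lam = qpoch (tsum lam).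
  by rewrite /qmult -E mulpK // pprod_neq0.
move: {2}(tsum lam) (erefl (tsum lam)) => L; elim: L lam => [|L IH] lam E.
  exists 1; rewrite E qpoch0 mul1r /pprod big1 // => s _.
  have : (lam s <= tsum lam)%N by rewrite /tsum (bigD1 s) //= leq_addr.
  by rewrite E leqn0 => /eqP ->; rewrite qpoch0.
have ex q : exists u, (0 < lam q)%N -> u * pprod (decr lam q) = qpoch L.
  case: (posnP (lam q)) => [_|pos]; first by exists 0.
  have /IH [u Eu] : tsum (decr lam q) = L by apply: succn_inj; rewrite tsum_dec.
  by exists u => _; rewrite Eu; congr qpoch; apply: succn_inj; rewrite tsum_dec.
have [u Eu] := choice ex.
exists (\sum_(q < n) 'X^(qexp lam n q) * (if (0 < lam q)%N then u q else 0)).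
rewrite mulr_suml E qpochS -E -(sum_qexp lam (leqnn n)) mulr_sumr.
apply: eq_bigr => q _; case: posnP => [z|pos].
  by rewrite z subrr !mulr0 mul0r.
by rewrite -(Eu q pos) (pprod_dec pos); move: 'X^(lam q) 'X^(qexp _ _ _) => a b; ring.
Qed.

Lemma qmult_rec (lam : comp) p : (0 < tsum lam)%N -> (p <= n)%N ->
  qmult lam = \sum_(q < n) (if (0 < lam q)%N then 'X^(qexp lam p q) * qmult (decr lam q) else 0).
Proof.
move=> pos pn; apply: (mulIf (pprod_neq0 lam)); rewrite qmult_mul mulr_suml.
have tE : tsum lam = (tsum lam).-1.+1 by rewrite prednK.
rewrite {1}tE qpochS -tE -(sum_qexp lam pn) mulr_sumr.
apply: eq_bigr => q _; case: posnP => [z|qpos].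
  by rewrite z subrr mulr0 mulr0 mul0r.
rewrite (pprod_dec qpos) -(tsum_dec qpos) /= -qmult_mul.
by move: 'X^(lam q) 'X^(qexp _ _ _) => a b; ring.
Qed.

End Multinomial.

(** * Weights represented by compositions, and the terms b_{L,i} *)

Section Boson.
Variables (n : nat) (hn : (2 <= n)%N).
Let npos : (0 < n)%N. Proof. lia. Qed.
Local Notation comp := {ffun 'I_n -> nat}.

Definition hsum (lam : comp) : wt n := \sum_s (lam s)%:R *: hatW n s.

Definition repc (lam : comp) (c : rat) (l : wt n) := l = hsum lam + c *: deltaW n.

Definition rep (lam : comp) (l : wt n) := exists c : int, repc lam c%:~R l.

Lemma hat_coord_hsum lam s : (s < n)%N ->
  hat_coord s (hsum lam) = (\sum_(t < n) (s == t)%:R * (lam t)%:R) - (tsum lam)%:R / n%:R.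
Proof.
move=> sn; rewrite /hsum /hat_coord form_sum // /tsum natr_sum mulr_suml -sumrB.
by apply: eq_bigr => t _; rewrite -/(hat_coord s (hatW n t)) hat_coord_hat //; ring.
Qed.

Lemma hat_coord_repc lam c l (s : 'I_n) : repc lam c l ->
  hat_coord s l = (lam s)%:R - (tsum lam)%:R / n%:R.
Proof.
move=> ->; rewrite hat_coordD // hat_coordZ // hat_coord_delta // mulr0 addr0 hat_coord_hsum //; congr (_ - _).
rewrite (bigD1 s) //= eqxx mul1r big1 ?addr0 // => t ne.
by rewrite [s == t :> nat]eq_sym val_eqE (negbTE ne) mul0r.
Qed.

(** Since the weights hat s add up to 0, a weight fixes its composition only up to a common
    constant; the total removes this freedom. *)
Lemma rep_uniq lam lam' l : rep lam l -> rep lam' l -> tsum lam = tsum lam' -> lam = lam'.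
Proof.
move=> [c H] [c' H'] E; apply/ffunP => s; apply/eqP; rewrite -(eqr_nat rat).
have := hat_coord_repc s H; rewrite (hat_coord_repc s H') E => /addIr ->.
by rewrite eqxx.
Qed.

Lemma level_hsum lam : level (hsum lam) = 0.
Proof.
rewrite /hsum (big_morph (@level n) (id1 := 0) (op1 := +%R)) ?big1 //.
- by move=> s _; rewrite levelZ level_hat // mulr0.
- by move=> u v; rewrite levelD.
by rewrite -(scale0r (0 : wt n)) levelZ mul0r.
Qed.

Lemma sqn_repc lam c l p : repc lam c l -> (p <= n)%N ->
  sqn (l - Lam n p) = \sum_s (lam s)%:R ^+ 2 - 2%:R * (psum lam p)%:R - 2%:R * c
    + p%:R - ((tsum lam)%:R - p%:R) ^+ 2 / n%:R.
Proof.
move=> H pn; rewrite /sqn.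
have levl : level l = 0 by rewrite H levelD level_hsum levelZ level_delta // mulr0 addr0.
have E1 : form l l = \sum_s (lam s)%:R ^+ 2 - (tsum lam)%:R ^+ 2 / n%:R.
  rewrite {1}H formDl // formZl // [form (deltaW n) l]formC // form_delta // levl mulr0 addr0.
  rewrite /hsum form_sum //.
  under eq_bigr => s _ do rewrite formC // -/(hat_coord s l) (hat_coord_repc s H).
  rewrite [in RHS]expr2 -mulrA -[(tsum lam)%:R * (_ / _)]mulrC.
  rewrite {2}/tsum natr_sum mulr_sumr -sumrB; apply: eq_bigr => s _; ring.
have E2 : form l (Lam n p) = (psum lam p)%:R - (tsum lam)%:R * p%:R / n%:R + c.
  rewrite H formDl // formZl // [form (deltaW n) _]formC // form_delta // level_Lam // mulr1.
  congr (_ + _); rewrite /hsum form_sum // /psum natr_sum [in RHS]big_mkcond /tsum natr_sum.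
  rewrite -mulrA mulr_suml -sumrB; apply: eq_bigr => s _.
  rewrite formC // -/(hat_coord s (Lam n p)) hat_coord_Lam //.
  by case: ltnP => _; rewrite /=; ring.
have E3 : form (Lam n p) (Lam n p) = p%:R - p%:R ^+ 2 / n%:R.
  by rewrite form_LamLam // /cinv minnn; ring.
rewrite formDl // !formDr // !formNl // !formNr // [form (Lam n p) l]formC // E1 E2 E3.
by ring.
Qed.

(* [bfun L i], as a function of the class p of i + L modulo n *)
Definition bterm (L p : nat) (l : wt n) : qterm :=
  match [pick lam | @brep n L l lam] with
  | Some lam => (sqn (l - Lam n p) / 2%:R, qpoch L %/ \prod_(s < n) qpoch (lam s))
  | None => (0, 0)
  end.

Lemma brepP L l (lam : {ffun 'I_n -> 'I_L.+1}) :
  brep l lam -> let lam' : comp := [ffun s => lam s : nat] in tsum lam' = L /\ rep lam' l.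
Proof.
move=> /and3P [/eqP E1 /eqP E2 /intrP [c Ec]] lam'.
have hE : hsum lam' = \sum_(s < n) (lam s : nat)%:R *: hatW n s.
  by apply: eq_bigr => s _; rewrite ffunE.
split; first by rewrite -[RHS]E1; apply: eq_bigr => s _; rewrite ffunE.
by exists c; rewrite /repc hE -Ec -E2 addrC subrK.
Qed.

Lemma brep_rep L l (lam : comp) : tsum lam = L -> rep lam l ->
  @brep n L l [ffun s => inord (lam s)].
Proof.
move=> E [c H].
have le s : (lam s <= L)%N by rewrite -E /tsum (bigD1 s) //= leq_addr.
have hE : \sum_(s < n) (([ffun s => inord (lam s)] : {ffun 'I_n -> 'I_L.+1}) s : nat)%:R *: hatW n s
   = hsum lam.
  by apply: eq_bigr => s _; rewrite ffunE inordK // ltnS.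
have mu : l - hsum lam = c%:~R *: deltaW n by rewrite H addrAC subrr add0r.
have mu0 : (c%:~R *: deltaW n : wt n) 0 ord_max = c%:~R.
  by rewrite -/(dcoef (c%:~R *: deltaW n : wt n)) dcoefZ dcoef_delta mulr1.
apply/and3P; split; rewrite ?hE ?mu ?mu0 ?intr_int //.
rewrite -[X in _ == X]E; apply/eqP/eq_bigr => s _.
by rewrite ffunE inordK // ltnS.
Qed.

Lemma bterm_rep L p l (lam : comp) : tsum lam = L -> rep lam l ->
  bterm L p l = (sqn (l - Lam n p) / 2%:R, qmult lam).
Proof.
move=> E R; rewrite /bterm; case: pickP => [mu Hmu|/(_ _) H]; last first.
  by have := H [ffun s => inord (lam s)]; rewrite brep_rep.
have [Es Rs] := brepP Hmu; rewrite (rep_uniq R Rs) ?Es ?E // /qmult Es /pprod.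
by congr (_, _ %/ _); apply: eq_bigr => s _; rewrite ffunE.
Qed.

Lemma bterm_norep L p l : (forall lam : comp, tsum lam = L -> ~ rep lam l) ->
  bterm L p l = (0, 0).
Proof.
move=> H; rewrite /bterm; case: pickP => // mu Hmu.
by have [Es Rs] := brepP Hmu; case: (H _ Es Rs).
Qed.

Lemma hsum_tperm (lam : comp) (i j : 'I_n) : i != j ->
  hsum [ffun s => lam (tperm i j s)] =
  hsum lam - ((lam i)%:R - (lam j)%:R) *: (hatW n i - hatW n j).
Proof.
move=> ne; rewrite /hsum (bigD1 i) //= (bigD1 j) 1?eq_sym //=.
rewrite [in RHS](bigD1 i) //= [in RHS](bigD1 j) 1?eq_sym //= !ffunE tpermL tpermR.
rewrite (eq_bigr (fun s => (lam s)%:R *: hatW n s)) => [|s /andP [si sj]]; last first.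
  by rewrite ffunE tpermD // eq_sym.
move: (hatW n i) (hatW n j) (\sum_(_ | _) _) => u v w.
by apply/rowP => b; rewrite !mxE; ring.
Qed.

Lemma rep_genmx (lam : comp) l (i : 'I_n) : rep lam l ->
  rep [ffun s => lam (tperm (Ordinal (prv_lt hn i)) i s)] (l *m genmx n i).
Proof.
move=> [c H]; set pi := Ordinal _.
have ne : pi != i by rewrite eq_sym -val_eqE /= prv_neq.
have col : wcoef l i = (lam pi)%:R - (lam i)%:R.
  rewrite (wcoef_fs hn) // -[prv n i]/(pi : nat) !(hat_coord_repc _ H).
  have -> : level l = 0 by rewrite H levelD level_hsum levelZ level_delta // mulr0 addr0.
  by ring.
(* Besides exchanging two parts, s_0 subtracts an integral multiple of the delta contained in
   alpha_0. *)
exists (c - ((i == 0 :> nat)%N : nat)%:Z * ((lam pi)%:Z - (lam i)%:Z)).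
rewrite /repc hsum_tperm // mul_genmxE // col alphaE // -[prv n i]/(pi : nat) {1}H.
rewrite !(intrB, intrM) -!pmulrn.
move: (hsum lam) (hatW n pi) (hatW n i) (deltaW n) => h u v d.
by apply/rowP => b; rewrite !mxE; ring.
Qed.

Lemma tsum_tperm (lam : comp) (i j : 'I_n) : tsum [ffun s => lam (tperm i j s)] = tsum lam.
Proof.
rewrite /tsum [RHS](reindex_inj (@perm_inj _ (tperm i j))).
by apply: eq_bigr => s _; rewrite ffunE.
Qed.

Lemma qmult_tperm (lam : comp) (i j : 'I_n) : qmult [ffun s => lam (tperm i j s)] = qmult lam.
Proof.
rewrite /qmult tsum_tperm /pprod [in RHS](reindex_inj (@perm_inj _ (tperm i j))).
by congr (_ %/ _); apply: eq_bigr => s _; rewrite ffunE.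
Qed.

(** s_i fixes Lambda_p, hence preserves the norm in the exponent, and it permutes the composition,
    hence preserves the q-multinomial. *)
Lemma bterm_genmx L p l (i : 'I_n) : (i != p %[mod n])%N ->
  bterm L p (l *m genmx n i) = bterm L p l.
Proof.
move=> ip; have [[lam [E R]]|H] := pselect (exists lam : comp, tsum lam = L /\ rep lam l).
  rewrite (bterm_rep _ E R) (bterm_rep _ _ (rep_genmx i R)) ?tsum_tperm // qmult_tperm.
  congr (_ / _, _); rewrite /sqn -[in RHS](@form_sref n hn _ _ i) // !mulmxBl.
  by rewrite (mul_genmxE hn (Lam n p)) // wcoef_Lam // (negbTE ip) scale0r subr0.
rewrite [RHS]bterm_norep => [|lam E R]; last by apply: H; exists lam.
rewrite bterm_norep // => lam E R; apply: H.
exists [ffun s => lam (tperm (Ordinal (prv_lt hn i)) i s)]; rewrite tsum_tperm; split=> //.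
by have := rep_genmx i R; rewrite sref_invol.
Qed.

(* |l - Lam_(q1+1)|^2 / 2 + qexp - |l - hat q - Lam_q|^2 / 2, which is independent
   of the weight l *)
Definition turn_exp (L q1 q : nat) : rat :=
  ((q1%:R - q%:R) + (2%:R * (L%:R - q1%:R) * (q1%:R - q%:R) + (q1%:R - q%:R) ^+ 2) / n%:R) / 2%:R
  + (if (q <= q1)%N then 0 else L.+1%:R).

Lemma hsum_dec (lam : comp) q : (0 < lam q)%N -> hsum (decr lam q) = hsum lam - hatW n q.
Proof.
move=> pos; rewrite /hsum (bigD1 q) //= [in RHS](bigD1 q) //= ffunE eqxx.
rewrite (eq_bigr (fun s => (lam s)%:R *: hatW n s)) => [|s /negbTE ne]; last first.
  by rewrite ffunE ne subn0.
by rewrite natrB // scalerBl scale1r addrAC.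
Qed.

Lemma psum_dec (lam : comp) (q : 'I_n) : psum (decr lam q) q = psum lam q.
Proof.
apply: eq_bigr => s sq; rewrite ffunE (_ : (s == q) = false) ?subn0 //.
by rewrite -val_eqE /=; lia.
Qed.

Lemma sum_sqr_dec (lam : comp) (q : 'I_n) : (0 < lam q)%N ->
  \sum_s (decr lam q s)%:R ^+ 2 = \sum_s (lam s)%:R ^+ 2 - 2%:R * (lam q)%:R + 1 :> rat.
Proof.
move=> pos; rewrite (bigD1 q) //= [in RHS](bigD1 q) //= ffunE eqxx.
rewrite (eq_bigr (fun s => (lam s)%:R ^+ 2)) => [|s /negbTE ne]; last first.
  by rewrite ffunE ne subn0.
by rewrite natrB //=; ring.
Qed.

(** The recurrence is started at p = q1 + 1, the index of the weight subtracted in the norm: then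
    the partial sums of the composition in [qexp] cancel those in the two norms, and the exponents
    no longer depend on l. *)
Lemma bterm_rec L q1 l x : (q1 < n)%N ->
  qcoef (bterm L.+1 q1.+1 l) x =
  \sum_(q < n) qcoef (bterm L q (l - hatW n q)) (x - turn_exp L q1 q).
Proof.
move=> qn; have [[lam [E R]]|H] := pselect (exists lam : comp, tsum lam = L.+1 /\ rep lam l).
  rewrite (bterm_rep _ E R) (@qmult_rec n lam q1.+1) ?E // qcoef_sum.
  apply: eq_bigr => q _; case: posnP => [z|pos].
    (* A composition of l - hat q would give one of l with a positive entry at q, which must be
       [lam] by uniqueness. *)
    rewrite qcoef0 bterm_norep ?qcoef0 // => mu Emu [c Rmu].
    pose mu' : comp := [ffun s => (mu s + (s == q))%N].
    have pos' : (0 < mu' q)%N by rewrite ffunE eqxx addn1.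
    have dmu : decr mu' q = mu by apply/ffunP => s; rewrite !ffunE addnK.
    have Emu' : tsum mu' = L.+1 by rewrite -(tsum_dec pos') dmu Emu.
    have Rmu' : rep mu' l.
      exists c; rewrite /repc; have := hsum_dec pos'; rewrite dmu => Eh.
      move: Rmu; rewrite /repc Eh => /(congr1 (fun u => u + hatW n q)).
      by rewrite subrK addrAC subrK.
    have := rep_uniq R Rmu' (etrans E (esym Emu')) => lamE.
    by move: pos'; rewrite -lamE z.
  have [c Rc] := R.
  have Ed : tsum (decr lam q) = L by apply: succn_inj; rewrite tsum_dec.
  have Rd : repc (decr lam q) c%:~R (l - hatW n q).
    by rewrite /repc hsum_dec // Rc addrAC.
  rewrite (bterm_rep q Ed (ex_intro _ c Rd)) qcoefXn -qcoef_shift.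
  congr (qcoef (_, _) x).
  rewrite (sqn_repc Rc) // (sqn_repc Rd) ?(ltnW (ltn_ord q)) // psum_dec sum_sqr_dec // Ed E.
  have := @qexp_lam n lam q1.+1 q qn; rewrite E => Eq.
  have {}Eq : (qexp lam q1.+1 q)%:R = (psum lam q1.+1)%:R
      + (if (q <= q1)%N then 0 else L.+1%:R) - (psum lam q)%:R - (lam q)%:R :> rat.
    have le : (psum lam q <= psum lam q1.+1 + (if (q < q1.+1) then 0 else L.+1))%N.
      case: ltnP => [qq|_]; first by rewrite addn0; apply: psum_le; exact: ltnW.
      by rewrite -E -psumn; apply: leq_trans (psum_le _ _) (leq_addl _ _); apply: ltnW.
    apply: (addIr (lam q)%:R); rewrite -natrD Eq natrB // natrD ltnS.
    by case: ifP => _; ring.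
  rewrite Eq /turn_exp -!natr1; move: (\sum_s _) (psum _ _)%:R (psum _ _)%:R => u v w.
  by have nz := n_neq0 hn; case: ifP => _; field.
rewrite bterm_norep => [|lam E R]; last by apply: H; exists lam.
rewrite qcoef0 big1 // => q _; rewrite bterm_norep ?qcoef0 // => mu Emu [c Rmu].
pose mu' : comp := [ffun s => (mu s + (s == q))%N].
have pos' : (0 < mu' q)%N by rewrite ffunE eqxx addn1.
have dmu : decr mu' q = mu by apply/ffunP => s; rewrite !ffunE addnK.
apply: H; exists mu'; split; first by rewrite -(tsum_dec pos') dmu Emu.
exists c; rewrite /repc; have := hsum_dec pos'; rewrite dmu => Eh.
move: Rmu; rewrite /repc Eh => /(congr1 (fun u => u + hatW n q)).
by rewrite subrK addrAC subrK.
Qed.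

End Boson.

(** * Alternating sums over the Weyl group *)

Section WeylSum.
Variables (n : nat) (hn : (2 <= n)%N) (j : nat).
Let npos : (0 < n)%N. Proof. lia. Qed.
Local Notation comp := {ffun 'I_n -> nat}.

Definition base_weight : wt n := Lam n 0 + Lam n j + rho n.

Lemma wcoef_rho a : wcoef (rho n) a = 1.
Proof.
rewrite /rho (big_morph (@wcoef n ^~ a) (id1 := 0) (op1 := +%R)).
- have am : (a %% n < n)%N by rewrite ltn_mod.
  rewrite (bigD1 (Ordinal am)) //= wcoef_Lam // modn_mod eqxx big1 ?addr0 // => t.
  by rewrite -val_eqE /= eq_sym wcoef_Lam // (modn_small (ltn_ord t)) => /negbTE ->.
- by move=> u v; rewrite wcoefD.
by rewrite -(scale0r (0 : wt n)) wcoefZ mul0r.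
Qed.

Lemma sdom_rho k k' : sdom (Lam n k + Lam n k' + rho n).
Proof.
move=> a _; rewrite 2!wcoefD !wcoef_Lam // wcoef_rho -!natrD.
by rewrite natr1 ltr0n.
Qed.

Definition weyl_term L p nu (w : 'M[rat]_(n.+1)) (x : rat) : rat :=
  (`[< @Weyl n w >] : nat)%:R * (\det w * qcoef (bterm L p (nu - base_weight *m w)) x).

Definition weyl_sum L p nu x := fsum (fun w => weyl_term L p nu w x).

Lemma weyl_term_neq0 L p nu w x : weyl_term L p nu w x != 0 ->
  @Weyl n w /\ exists lam : comp, tsum lam = L /\ rep lam (nu - base_weight *m w).
Proof.
move=> nz; split.
  by apply: contrapT => H; move: nz; rewrite /weyl_term asboolF // mul0r eqxx.
apply: contrapT => H; move: nz; rewrite /weyl_term bterm_norep ?qcoef0 ?mulr0 ?eqxx //.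
by move=> lam E R; apply: H; exists lam.
Qed.

(** A contributing w is determined by its composition, by [Weyl_regular], and there are finitely
    many compositions of L. *)
Lemma fsupp_weyl_term L p nu x : fsupp (fun w => weyl_term L p nu w x).
Proof.
pose f (w : 'M[rat]_(n.+1)) : option {ffun 'I_n -> 'I_L.+1} :=
  if `[< @Weyl n w >] then [pick lam | @brep n L (nu - base_weight *m w) lam] else None.
have fin : finite_set (f @^-1` [set o | o != None])%classic.
  apply: finite_preimage; last exact: finite_finset.
  move=> w w'; rewrite !inE /f /=; case: asboolP => // Ww.
  case: pickP => // lam Hlam _; case: asboolP => // Ww'.
  case: pickP => // lam' Hlam' _ [E]; move: Hlam'; rewrite -E => Hlam'.
  have [_ [c Ec]] := brepP Hlam; have [_ [c' Ec']] := brepP Hlam'.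
  apply: (@Weyl_regular n hn _ _ base_weight (c'%:~R - c%:~R)) => //; first exact: sdom_rho.
  have -> : base_weight *m w - base_weight *m w' = (nu - base_weight *m w') - (nu - base_weight *m w).
    by rewrite opprB [RHS]addrC addrA subrK.
  rewrite Ec Ec'; move: (hsum _) (deltaW n) => u v; apply/rowP => b; rewrite !mxE; ring.
apply: fsuppS fin _ => w /weyl_term_neq0 [Ww [lam [E R]]] /=.
rewrite /f asboolT //; case: pickP => // /(_ [ffun s => inord (lam s)]).
by rewrite brep_rep.
Qed.

Lemma weyl_sum_rec L q1 nu x : (q1 < n)%N ->
  weyl_sum L.+1 q1.+1 nu x = \sum_(q < n) weyl_sum L q (nu - hatW n q) (x - turn_exp n L q1 q).
Proof.
move=> qn; rewrite /weyl_sum -fsum_sum; last by move=> q; exact: fsupp_weyl_term.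
congr (fsum _); apply/funext => w; rewrite /weyl_term bterm_rec // !mulr_sumr.
apply: eq_bigr => q _.
have -> : nu - hatW n q - base_weight *m w = nu - base_weight *m w - hatW n q by rewrite addrAC.
by [].
Qed.

(** Multiplying w by s_i is a sign-reversing involution: s_i fixes nu, so it acts on the whole
    argument of [bterm], which does not notice it. *)
Lemma weyl_sum_wall L q nu x (i : 'I_n) : wcoef nu i = 0 -> (i != q %[mod n])%N -> weyl_sum L q nu x = 0.
Proof.
move=> ci iq; pose h (w : 'M[rat]_(n.+1)) := w *m genmx n i.
have hh : cancel h h by move=> w; rewrite /h -mulmxA (genmx_invol hn (ltn_ord i)) mulmx1.
have anti w : weyl_term L q nu (h w) x = - weyl_term L q nu w x.
  have Wh : `[< @Weyl n (h w) >] = `[< @Weyl n w >].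
    apply: asbool_equiv_eq; split => H; last exact: (Weyl_genmx i H).
    by have := Weyl_genmx i H; rewrite -/(h (h w)) hh.
  have Ed : \det (h w) = - \det w by rewrite /h det_mulmx (det_genmx hn (ltn_ord i)) mulrN1.
  have Em : nu - base_weight *m h w = (nu - base_weight *m w) *m genmx n i.
    by rewrite mulmxBl -mulmxA (mul_genmxE hn nu (ltn_ord i)) ci scale0r subr0.
  have Eb : bterm L q (nu - base_weight *m h w) = bterm L q (nu - base_weight *m w).
    by rewrite Em; exact: bterm_genmx.
  rewrite /weyl_term; move: Wh Ed Eb; move: (bterm _ _ _) (bterm _ _ _) (\det (h w)) (asbool _).
  by move=> b1 b2 d1 a1 -> -> ->; rewrite mulNr mulrN.
have E : weyl_sum L q nu x = - weyl_sum L q nu x.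
  rewrite {1}/weyl_sum (@fsum_bij _ _ h); last by exists h.
  rewrite -fsumN; congr (fsum _); apply/funext => w; exact: anti.
by move: E; move: (weyl_sum _ _ _ _) => s; lra.
Qed.

Lemma bterm_mod L p p' (l : wt n) : p = p' %[mod n] -> bterm L p l = bterm L p' l.
Proof. by move=> E; rewrite /bterm (Lam_eq E). Qed.

(* the pointers end at k and k', and k' is the one which would move next *)
Definition bose L k k' x :=
  weyl_sum L k' (Lam n k + Lam n k' + rho n) (x - (sqn (Lam n k) - sqn (Lam n j)) / 2%:R).

Lemma bose_mod L k k' l l' x : k = l %[mod n] -> k' = l' %[mod n] ->
  bose L k k' x = bose L l l' x.
Proof.
move=> E E'; rewrite /bose (Lam_eq E) (Lam_eq E') /weyl_sum; congr (fsum _).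
by apply/funext => w; rewrite /weyl_term (bterm_mod _ _ E').
Qed.

Lemma sqn_Lam t : (t <= n)%N -> sqn (Lam n t) = t%:R - t%:R ^+ 2 / n%:R.
Proof. by move=> tn; rewrite /sqn form_LamLam // /cinv minnn; ring. Qed.

Lemma modnS_mod (a : nat) : (a %% n).+1 = a.+1 %[mod n].
Proof. by rewrite -addn1 modnDml addn1. Qed.

Lemma modS_neq (a : nat) : (a.+1 == a %[mod n]) = false.
Proof.
apply/negbTE; rewrite -addn1 -{2}[a]addn0 eqn_modDl mod0n modn_small //.
Qed.

(** Subtracting hat q cancels the coefficient 1 of rho at q + 1, which only Lambda_{k+1} or
    Lambda_{k+r+1} could restore. The reflection s_{q+1} is admissible because q + 1 and q differ
    modulo n. *)
Lemma bose_wall L k r (q : 'I_n) x : (q != k %[mod n])%N -> (q != k + r %[mod n])%N ->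
  weyl_sum L q (Lam n k.+1 + Lam n (k + r).+1 + rho n - hatW n q) x = 0.
Proof.
move=> qk qkr; have im : (q.+1 %% n < n)%N by rewrite ltn_mod.
apply: (@weyl_sum_wall _ _ _ _ (Ordinal im)); last by rewrite /= modn_mod modS_neq.
rewrite /hatW /= !(wcoefD, wcoefN) !wcoef_Lam // !wcoef_rho !modn_mod eqxx modS_neq.
have eqS (a b : nat) : (a.+1 == b.+1 %[mod n]) = (a == b %[mod n]).
  by rewrite -[a.+1]addn1 -[b.+1]addn1 eqn_modDr.
by rewrite !eqS (negbTE qk) (negbTE qkr) /=; ring.
Qed.

Lemma add_hat (u : wt n) q : u + Lam n q.+1 + rho n - hatW n q = u + Lam n q + rho n.
Proof.
rewrite /hatW; move: (Lam n q.+1) (Lam n q) (rho n) => v w t.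
by apply/rowP => b; rewrite !mxE; ring.
Qed.

(** The normalization of [bose] reduces [turn_exp] to the cost (L + 1) r / n. Here q1 and q2 are
    residues and r is the cyclic distance from q2 to q1, which explains the n added on passing 0. *)
Lemma turn_expE L (q1 q2 r : nat) (s x : rat) :
  (q2 + r = q1 + (if (q2 <= q1)%N then 0 else n))%N ->
  x - L.+1%:R * r%:R / n%:R - (q1.+1%:R - q1.+1%:R ^+ 2 / n%:R - s) / 2%:R =
  x - (q2.+1%:R - q2.+1%:R ^+ 2 / n%:R - s) / 2%:R - turn_exp n L q1 q2.
Proof.
move=> /(congr1 (fun a => a%:R : rat)); rewrite !natrD => E.
have {E} -> : r%:R = q1%:R - q2%:R + (if (q2 <= q1)%N then 0 else n%:R) :> rat.
  apply: (addrI q2%:R); rewrite E; case: ifP => _; ring.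
rewrite /turn_exp -!natr1; have nz := n_neq0 hn.
by case: ifP => _; field.
Qed.

Lemma modnD_wrap (k r : nat) : (r < n)%N ->
  (k %% n + r = (k + r) %% n + (if (k %% n <= (k + r) %% n)%N then 0 else n))%N.
Proof.
move=> rn; rewrite modnD // (modn_small rn); have := ltn_mod k n; rewrite npos.
move: (k %% n)%N => a an; have [H|H] := leqP n (a + r).
  by rewrite mul1n (_ : (a <= a + r - n)%N = false); lia.
by rewrite mul0n subn0 leq_addr addn0.
Qed.

Lemma sum_two (f : 'I_n -> rat) (a b : 'I_n) : a != b ->
  (forall q, q != a -> q != b -> f q = 0) -> \sum_q f q = f a + f b.
Proof.
move=> ne H; rewrite (bigD1 a) //= (bigD1 b) 1?eq_sym //= big1 ?addr0 // => q /andP [qa qb].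
exact: H.
Qed.

Lemma bose_rec L k r x : (0 < r < n)%N ->
  bose L.+1 k.+1 (k + r).+1 x =
  bose L k.+1 (k + r) x + bose L (k + r).+1 k (x - L.+1%:R * r%:R / n%:R).
Proof.
move=> Hr; have m1 : ((k + r) %% n < n)%N by rewrite ltn_mod.
have m2 : (k %% n < n)%N by rewrite ltn_mod.
pose q1 := Ordinal m1; pose q2 := Ordinal m2.
have E1 : (k + r).+1 = q1.+1 %[mod n] by rewrite /= modnS_mod.
have E2 : k.+1 = q2.+1 %[mod n] by rewrite /= modnS_mod.
have ne : q1 != q2.
  rewrite -val_eqE /= -{2}[k]addn0 eqn_modDl mod0n modn_small; last by case/andP: Hr.
  by case/andP: Hr; rewrite lt0n.
have -> : bose L.+1 k.+1 (k + r).+1 x = \sum_(q < n)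
    weyl_sum L q (Lam n k.+1 + Lam n q1.+1 + rho n - hatW n q)
      (x - (sqn (Lam n k.+1) - sqn (Lam n j)) / 2%:R - turn_exp n L q1 q).
  by rewrite (@bose_mod _ _ _ k.+1 q1.+1) // /bose weyl_sum_rec.
rewrite (sum_two ne) => [|q qa qb]; last first.
  rewrite -(Lam_eq E1); apply: bose_wall; rewrite (modn_small (ltn_ord q)) //.
have -> : bose L k.+1 (k + r) x = weyl_sum L q1 (Lam n k.+1 + Lam n q1.+1 + rho n - hatW n q1)
    (x - (sqn (Lam n k.+1) - sqn (Lam n j)) / 2%:R - turn_exp n L q1 q1).
  rewrite (@bose_mod _ _ _ k.+1 q1 _ (erefl _) (esym (modn_mod _ _))) /bose.
  have -> : turn_exp n L q1 q1 = 0 by rewrite /turn_exp leqnn subrr; ring.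
  by rewrite subr0 add_hat.
have -> : bose L (k + r).+1 k (x - L.+1%:R * r%:R / n%:R) =
    weyl_sum L q2 (Lam n k.+1 + Lam n q1.+1 + rho n - hatW n q2)
    (x - (sqn (Lam n k.+1) - sqn (Lam n j)) / 2%:R - turn_exp n L q1 q2); last by [].
rewrite (@bose_mod _ (k + r).+1 k q1.+1 q2 _ E1 (esym (modn_mod _ _))) /bose.
have -> : Lam n q1.+1 + Lam n q2 + rho n = Lam n k.+1 + Lam n q1.+1 + rho n - hatW n q2.
  by rewrite (Lam_eq E2) [Lam n q2.+1 + _]addrC add_hat.
rewrite (Lam_eq E2) !(@sqn_Lam _.+1) //.
rewrite (turn_expE _ _ _ (q1 := (k + r) %% n) (q2 := k %% n)) //.
by apply: modnD_wrap; case/andP: Hr.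
Qed.

Lemma bose_rec0 L k x : bose L.+1 k.+1 k.+1 x = bose L k.+1 k x.
Proof.
have m1 : (k %% n < n)%N by rewrite ltn_mod.
pose q1 := Ordinal m1.
have E1 : k.+1 = q1.+1 %[mod n] by rewrite /= modnS_mod.
have -> : bose L.+1 k.+1 k.+1 x = \sum_(q < n)
    weyl_sum L q (Lam n k.+1 + Lam n q1.+1 + rho n - hatW n q)
      (x - (sqn (Lam n k.+1) - sqn (Lam n j)) / 2%:R - turn_exp n L q1 q).
  by rewrite (@bose_mod _ _ _ k.+1 q1.+1) // /bose weyl_sum_rec.
rewrite (bigD1 q1) //= big1 ?addr0 => [|q qa]; last first.
  have := @bose_wall L k 0 q; rewrite addn0 -(Lam_eq E1).
  by apply; rewrite (modn_small (ltn_ord q)).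
rewrite [in RHS](@bose_mod _ _ _ k.+1 q1) ?modn_mod // /bose.
have -> : turn_exp n L (k %% n) (k %% n) = 0 by rewrite /turn_exp leqnn subrr; ring.
by rewrite subr0 add_hat.
Qed.

End WeylSum.

(** * Comparison *)

Section Final.
Variables (n : nat) (hn : (2 <= n)%N) (j : nat) (hj : (j < n)%N).
Let npos : (0 < n)%N. Proof. lia. Qed.
Local Notation comp := {ffun 'I_n -> nat}.
Local Notation B := (bose n j).
Local Notation F := (fermi n j).

Lemma sqn_Lam_mod t t' : t = t' %[mod n] -> sqn (Lam n t) = sqn (Lam n t').
Proof. by move=> /Lam_eq ->. Qed.

Lemma tsum0 (lam : comp) : tsum lam = 0%N -> lam = [ffun=> 0%N].
Proof.
move=> E; apply/ffunP => s; rewrite ffunE; apply/eqP.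
by rewrite -leqn0 -E /tsum (bigD1 s) //= leq_addr.
Qed.

Lemma hsum0 : hsum [ffun=> 0%N] = 0 :> wt n.
Proof. by rewrite /hsum big1 // => s _; rewrite ffunE scale0r. Qed.

(** The only composition is 0, so a contributing w carries [base_weight] to nu modulo delta. Both
    weights are strictly dominant, hence w = 1. *)
Lemma bose_init k k' x : (k + k' = j %[mod n])%N ->
  B 0 k k' x = ((n %| k) || (n %| k'))%N%:R * qcoef (0, 1) x.
Proof.
move=> Ekk; rewrite /bose /weyl_sum; set nu := Lam n k + _ + _; set y := x - _.
have dnu : sdom nu by exact: sdom_rho.
have dmu : sdom (base_weight n j) by exact: sdom_rho.
rewrite (@fsum_set1 _ _ 1%:M) => [|w wn1]; last first.
  have [//|/weyl_term_neq0 [Ww [lam [/tsum0 -> [c Ec]]]]] := eqVneq (weyl_term j 0 k' nu w y) 0.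
  case/eqP: wn1; apply: (@Weyl_dominant n hn w nu (base_weight n j) c%:~R) => //.
  by rewrite Ec hsum0 add0r.
rewrite /weyl_term asboolT; last exact: Weyl_id.
rewrite det1 !mul1r mulmx1.
have [div|ndiv] := boolP ((n %| k) || (n %| k'))%N.
  have Emu : Lam n k + Lam n k' = Lam n 0 + Lam n j.
    case/orP: div => [/dvdnP [q Eq]|/dvdnP [q Eq]].
      congr (_ + _); apply: Lam_eq; first by rewrite Eq modnMl mod0n.
      by rewrite -Ekk Eq modnMDl.
    rewrite addrC; congr (_ + _); apply: Lam_eq; first by rewrite Eq modnMl mod0n.
    by rewrite -Ekk Eq addnC modnMDl.
  have Esq : sqn (Lam n k) + sqn (Lam n k') = sqn (Lam n j).
    have s0 : sqn (Lam n 0) = 0 by rewrite sqn_Lam // expr2 mulr0 mul0r subrr.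
    case/orP: div => [/dvdnP [q Eq]|/dvdnP [q Eq]].
      rewrite (@sqn_Lam_mod k 0) ?s0 ?add0r; last by rewrite Eq modnMl mod0n.
      by apply: sqn_Lam_mod; rewrite -Ekk Eq modnMDl.
    rewrite (@sqn_Lam_mod k' 0) ?s0 ?addr0; last by rewrite Eq modnMl mod0n.
    by apply: sqn_Lam_mod; rewrite -Ekk Eq addnC modnMDl.
  have -> : nu - base_weight n j = 0 by rewrite /nu /base_weight Emu subrr.
  have t0 : tsum ([ffun=> 0%N] : comp) = 0%N by rewrite /tsum big1 // => s _; rewrite ffunE.
  rewrite (bterm_rep hn _ t0); last by exists 0; rewrite /repc hsum0 scale0r addr0.
  have -> : qmult ([ffun=> 0%N] : comp) = 1.
    have := qmult_mul ([ffun=> 0%N] : comp); rewrite t0 qpoch0.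
    by rewrite /pprod big1 ?mulr1 // => s _; rewrite ffunE qpoch0.
  rewrite -qcoef_shift mul1r sub0r; congr (qcoef (_, _) x).
  have -> : sqn (- Lam n k') = sqn (Lam n k') by rewrite /sqn formNl // formNr // opprK.
  rewrite -Esq.
  by move: (sqn _) (sqn _) => a b; field.
(* At index 0 neither Lambda_k nor Lambda_k' contributes, whereas [base_weight] contains
   Lambda_0. *)
rewrite mul0r bterm_norep ?qcoef0 // => lam /tsum0 -> [c].
rewrite /repc hsum0 add0r => /(congr1 (fun u => wcoef u 0)).
rewrite wcoefZ wcoef_delta // mulr0 /nu /base_weight !wcoefD wcoefN !wcoefD !wcoef_rho // !wcoef_Lam // eqxx.
move: ndiv; rewrite negb_or /dvdn => /andP [nk nk'].
rewrite mod0n eq_sym (negbTE nk) eq_sym (negbTE nk') /=.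
have : (0 : rat) <= (0%N == j %[mod n])%:R by [].
by rewrite mod0n; move: (_ == _)%:R => a; lra.
Qed.

Local Opaque bose fermi.

Lemma mod_succ_inj (a b : nat) : a.+1 = b.+1 %[mod n] -> a = b %[mod n].
Proof. by rewrite -[a.+1]addn1 -[b.+1]addn1 => /eqP; rewrite eqn_modDr => /eqP. Qed.

(** The congruence reads k + k' = L + j for k' = k + r: every step increments one of the
    pointers. *)
Definition agree L := forall k r x, (0 < r <= n)%N -> (2 * k + r = L + j %[mod n])%N ->
  F k L r x = B L k (k + r) x.

Lemma agree0 L k r x : agree L -> (r <= n)%N -> (2 * k + r = L + j %[mod n])%N ->
  F k L r x = B L k (k + r) x.
Proof.
move=> H rn E; have [r0|rpos] := posnP r; last by apply: H; rewrite ?rpos.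
have Hn : (0 < n <= n)%N by rewrite npos leqnn.
have En : (2 * k + n = L + j %[mod n])%N by rewrite modnDr -E r0 addn0.
have Mn : (k + n = k + 0 %[mod n])%N by rewrite addn0 modnDr.
rewrite r0 (fermi_0n hn) (H _ _ _ Hn En).
exact: (@bose_mod n j L _ _ _ _ x (erefl _) Mn).
Qed.

Lemma agree_init : agree 0.
Proof.
move=> k r x rn E; rewrite add0n in E.
by rewrite fermi_init // bose_init // addnA addnn -mul2n.
Qed.

Lemma agree_n L k x : agree L -> (2 * k + n = L.+1 + j %[mod n])%N ->
  F k L.+1 n x = B L.+1 k (k + n) x.
Proof.
move=> PL E.
have En : (2 * k + n.-1 = L + j %[mod n])%N.
  by apply: mod_succ_inj; rewrite -addnS prednK // E.
have eS : (k + n = (k + n.-1).+1)%N by rewrite -addnS prednK.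
have M1 : (k = (k + n.-1).+1 %[mod n])%N by rewrite -eS modnDr.
rewrite (fermi_n hn) (agree0 _ PL (leq_pred n) En) eS.
rewrite (@bose_mod n j L.+1 _ _ _ _ x M1 (erefl _)) (bose_rec0 hn).
exact: (@bose_mod n j L _ _ _ _ x M1 (erefl _)).
Qed.

(** [bose_rec], applied to both orders of the pointers, produces the term with pointers (k + r + 2,
    k) twice at the same exponent; eliminating it leaves this relation. *)
Lemma bose_turn L k r x : (0 < r < n)%N ->
  B L.+1 k.+1 (k + r).+2 (x - (r%:R - L.+1%:R) / n%:R)
  + B L k.+1 (k + r).+1 (x - (r%:R - L.+1%:R) / n%:R - L.+1%:R)
  - B L k.+1 (k + r).+1 (x - (r%:R - L.+1%:R) / n%:R)
  = B L.+1 (k + r).+2 k.+1 (x - L.+2%:R * r%:R / n%:R).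
Proof.
move=> Hr; have nz := n_neq0 hn.
have ez : x - L.+2%:R * r%:R / n%:R =
    x - (r%:R - L.+1%:R) / n%:R - L.+1%:R * r.+1%:R / n%:R.
  by rewrite -!natr1; field.
rewrite ez; move: (x - (r%:R - L.+1%:R) / n%:R) => y {x ez}.
(* For r + 1 = n the pointers k + 1 and k + r + 2 coincide modulo n, and [bose_rec0] takes the place
   of [bose_rec]. *)
have [rn|rn] := eqVneq r.+1 n.
  have M1 : ((k + r).+2 = k.+1 %[mod n])%N.
    by rewrite (_ : (k + r).+2 = k.+1 + n)%N ?modnDr //; lia.
  have M2 : (k = (k + r).+1 %[mod n])%N.
    by rewrite (_ : (k + r).+1 = k + n)%N ?modnDr //; lia.
  have -> : y - L.+1%:R * r.+1%:R / n%:R = y - L.+1%:R by rewrite rn mulfK.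
  rewrite (@bose_mod n j L.+1 _ _ _ _ y (erefl _) M1) (bose_rec0 hn).
  rewrite (@bose_mod n j L k.+1 k k.+1 (k + r).+1 y (erefl _) M2) addrAC subrr add0r.
  rewrite (@bose_mod n j L.+1 _ k.+1 _ (k + r).+2 _ (erefl _) (esym M1)) (bose_rec0 hn).
  exact: (@bose_mod n j L _ _ _ _ _ (esym M1) (erefl _)).
have Hr1 : (0 < r.+1 < n)%N by lia.
have Hr2 : (0 < n.-1 - r < n)%N by lia.
have e1 : (k + r.+1).+1 = (k + r).+2 by rewrite addnS.
have e2 : (((k + r).+1 + (n.-1 - r)).+1 = k.+1 + n)%N by lia.
have e3 : ((k + r).+1 + (n.-1 - r) = k + n)%N by lia.
have M1 : (k.+1 = ((k + r).+1 + (n.-1 - r)).+1 %[mod n])%N by rewrite e2 modnDr.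
have M2 : ((k + r).+1 + (n.-1 - r) = k %[mod n])%N by rewrite e3 modnDr.
rewrite -e1 (bose_rec hn j L k y Hr1) e1 addnS.
rewrite (@bose_mod n j L.+1 (k + r).+2 k.+1 _ _ _ (erefl _) M1) (bose_rec hn j L (k + r).+1 _ Hr2).
rewrite (@bose_mod n j L (k + r).+2 _ (k + r).+2 k _ (erefl _) M2).
rewrite (@bose_mod n j L _ (k + r).+1 k.+1 _ (y - _ - _) (esym M1) (erefl _)).
have -> : y - L.+1%:R * r.+1%:R / n%:R - L.+1%:R * (n.-1 - r)%:R / n%:R = y - L.+1%:R.
  rewrite natrB; last by lia.
  by rewrite (natr_predn hn) -!natr1; field.
by ring.
Qed.

Lemma agree_pred L K r x : agree L -> (0 < r < n)%N ->
  (2 * K + r.+1 = L + j %[mod n])%N -> F K.+1 L r.-1 x = B L K.+1 (K + r) x.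
Proof.
move=> PL Hr E; have [r0 rn] := andP Hr.
have e1 : (2 * K.+1 + r.-1 = 2 * K + r.+1)%N by clear -r0; lia.
have e2 : (K + r = K.+1 + r.-1)%N by clear -r0; lia.
have rn' : (r.-1 <= n)%N by apply: leq_trans (leq_pred r) (ltnW rn).
by rewrite e2; apply: agree0 PL rn' _; rewrite e1.
Qed.

(** The bosonic recurrence returns the pointers in exchanged order, which is harmless here since
    [bose_init] is symmetric in them. *)
Lemma agree_step0 K r x : (0 < r < n)%N ->
  (2 * K + r.+1 = j %[mod n])%N -> F K.+1 1 r x = B 1 K.+1 (K + r).+1 x.
Proof.
move=> Hr E; have [r0 rn] := andP Hr.
rewrite (fermi_rec0 hn j K x Hr) (bose_rec hn j 0 K x Hr) (agree_pred x agree_init Hr E) mul1r.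
have E' : (K + (K + r.+1) = j %[mod n])%N by rewrite addnA addnn -mul2n.
have E'' : ((K + r).+1 + K = j %[mod n])%N by rewrite addnC -addnS.
rewrite (agree0 _ agree_init rn E) (bose_init _ E') (bose_init _ E'').
by rewrite addnS orbC.
Qed.

Lemma agree_stepS L K r x : agree L -> agree L.+1 -> (0 < r < n)%N ->
  (2 * K.+1 + r.+1 = L.+1 + j %[mod n])%N ->
  F K.+2 L.+2 r x = B L.+2 K.+2 (K.+1 + r).+1 x.
Proof.
move=> PL PL1 Hr E; have [r0 rn] := andP Hr.
have E2 : (2 * K.+1 + r = L + j %[mod n])%N by apply: mod_succ_inj; rewrite -addnS E.
rewrite (fermi_recS hn j L K.+1 x Hr) /= (bose_rec hn j L.+1 K.+1 x Hr).
rewrite (agree_pred x PL1 Hr E) (agree0 _ PL1 rn E) !(agree0 _ PL (ltnW rn) E2).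
have := bose_turn L K x Hr; rewrite addnS !addSn => <-.
by move: (B _ _ _ _) (B _ _ _ _) (B _ _ _ _) (B _ _ _ _) => b1 b2 b3 b4; ring.
Qed.

Lemma agree_step L : agree L -> (forall L', L = L'.+1 -> agree L') -> agree L.+1.
Proof.
move=> PL PL' k r x Hr E; have [r0 rn] := andP Hr.
move: rn; rewrite leq_eqVlt => /orP [/eqP rn|rn].
  by rewrite rn in E *; exact: agree_n.
have {}Hr : (0 < r < n)%N by rewrite r0.
(* The recurrences speak of successors of k; adding n to k provides them and changes neither
   side. *)
have [K EK] : exists K, (k + n = K.+2)%N by exists (k + n).-2; clear -hn; lia.
have E1 : (2 * K.+1 + r.+1 = L + j %[mod n])%N.
  apply: mod_succ_inj; rewrite -addSn -E -(modnMDl 2 (2 * k + r)).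
  by congr (_ %% _)%N; clear -EK; lia.
have M1 : (k = K.+2 %[mod n])%N by rewrite -EK modnDr.
have M2 : (k + r = (K.+1 + r).+1 %[mod n])%N by rewrite -addSn -EK addnAC modnDr.
rewrite (@bose_mod n j L.+1 _ _ _ _ x M1 M2) -(fermi_addn hn) EK.
case: L => [|L] in PL PL' E E1 *; first exact: agree_step0.
by apply: agree_stepS => //; exact: PL'.
Qed.

Lemma fermi_eq_bose L k r x : (r <= n)%N -> (2 * k + r = L + j %[mod n])%N ->
  F k L r x = B L k (k + r) x.
Proof.
apply: agree0; have [//] : agree L /\ agree L.+1.
elim: L => [|L [IH1 IH2]]; split=> //.
- exact: agree_init.
- by apply: agree_step => //; exact: agree_init.
by apply: agree_step => // L' [<-].
Qed.

End Final.

Lemma int_mod_nat (n a : nat) (z : int) : (0 < n)%N -> (z = a%:Z %[mod n%:Z])%Z ->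
  `|(z %% n%:Z)%Z|%N = a %[mod n].
Proof. by move=> n0 ->; rewrite modz_nat absz_nat modn_mod. Qed.

Lemma rhs_termE n L j k w x : (2 <= n)%N -> (k < n)%N -> @Weyl n w ->
  let k' := (j + L + n - k)%N in
  qcoef (rhs_term L j k w) x =
  weyl_term j L k' (Lam n k + Lam n k' + rho n) w (x - (sqn (Lam n k) - sqn (Lam n j)) / 2%:R).
Proof.
move=> hn kn Ww k'; rewrite /weyl_term asboolT // mul1r.
rewrite /rhs_term qcoefZ; congr (_ * _); rewrite -[Lam n (j + L + n - k)]/(Lam n k').
set l := _ - _; rewrite addrC qcoef_shift; set y := x - _.
have -> : bterm L k' l = bfun L (j%:Z - k%:Z) l.
  rewrite (bterm_mod _ _ (esym (_ : `|((j%:Z - k%:Z + L%:Z) %% n%:Z)%Z|%N = k' %[mod n]))) //.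
  apply: int_mod_nat; first by lia.
  have -> : k'%:Z = j%:Z - k%:Z + L%:Z + n%:Z by rewrite /k'; lia.
  by rewrite modzDr.
by case: (bfun _ _ _).
Qed.

Lemma rhs_sum n L j k x : (2 <= n)%N -> (k < n)%N ->
  finite_set [set w | @Weyl n w /\ qcoef (rhs_term L j k w) x != 0] /\
  \sum_(w \in @Weyl n) qcoef (rhs_term L j k w) x = bose n j L k (j + L + n - k) x.
Proof.
move=> hn kn; set k' := (j + L + n - k)%N.
set nu := Lam n k + Lam n k' + rho n.
set y := x - (sqn (Lam n k) - sqn (Lam n j)) / 2%:R.
split.
  apply: sub_finite_set (fsupp_weyl_term hn j L k' nu y) => w [Ww] /=.
  by rewrite rhs_termE.
rewrite fsbig_mkcond /bose /weyl_sum /fsum; apply: eq_fsbigr => w _; rewrite /functions.patch.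
case: ifPn; rewrite ?inE ?notin_setE => Ww; first by rewrite rhs_termE.
by rewrite /weyl_term asboolF // mul0r.
Qed.

Theorem theorem4 (n L j k r : nat) (hn : (2 <= n)%N) (hj : (j < n)%N) (hk : (k < n)%N)
  (hr : (1 <= r <= n)%N)
  (hrmod : ((L + j)%:Z - 2%:Z * k%:Z = r%:Z %[mod n%:Z])%Z) :
  qseries_eq (@lhs_dom n k) (@lhs_term n L j r) (@Weyl n) (@rhs_term n L j k).
Proof.
move=> x; have [fin sumE] := rhs_sum L j x hn hk.
split; [exact: lhs_finite | split=> //].
have rn : (r <= n)%N by case/andP: hr.
have E : (2 * k + r = L + j %[mod n])%N.
  apply/eqP; rewrite -[(_ == _ %[mod n])%N]/(((2 * k + r) %% n)%N == ((L + j) %% n)%N).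
  rewrite -eqz_nat -!modz_nat; apply/eqP.
  have -> : (L + j)%N%:Z = 2%:Z * k%:Z + ((L + j)%:Z - 2%:Z * k%:Z) by ring.
  by rewrite -[RHS]modzDmr hrmod modzDmr.
rewrite sumE lhs_sum // fermi_eq_bose //; apply: bose_mod => //.
(* Adding k to both sides turns the pointer k + r into 2 k + r, and the pointer j + L + n - k of the
   statement into j + L + n. *)
apply/eqP; rewrite -(eqn_modDl k) addnA addnn -mul2n E subnKC; last by lia.
by rewrite modnDr addnC.
Qed.
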